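(* Let $E, F$ be real Banach spaces and let $E_0$ be a subspace of $E$. Let $T\in \mathcal L(E_0,F)$ and assume that there exists a Lipschitz function $f\colon E\rightarrow F$ such that $f|_{E_0}=T$. If $f$ belongs to a maximal Banach Lipschitz operator ideal $\mathcal I$ that is invariant under translations, then there exists an operator $R\in \mathcal I\cap \mathcal L(E,F'')$ such that $R|_{E_0}=T$ (that is, $R|_{E_0}=k_F\circ T$, where $k_F\colon F\to F''$ is the canonical inclusion into the bidual) and $\|R\|_{\mathcal I} \leq \|f\|_{\mathcal I}$.
   Context: All Banach spaces are real. $E'$ denotes the (topological) dual of $E$, $E''$ its bidual, and $\mathcal L(E,F)$ is the space of bounded linear operators from $E$ to $F$. Pointed metric spaces have distinguished point denoted $0$; every Banach space is a pointed metric space with distinguished point $0$, and a subset containing $0$ is a pointed metric space with the same distinguished point. For pointed metric spaces $X,Y$, $\mathrm{Lip}_0(X,Y)$ is the set of Lipschitz maps $f\colon X\to Y$ with $f(0)=0$, and $\mathrm{Lip}(f)$ is the least Lipschitz constant of $f$. Banach Lipschitz operator ideal: a subclass $\mathcal I$ of $\mathrm{Lip}_0$ together with a function $\|\cdot\|_{\mathcal I}\colon \mathcal I\to[0,\infty)$ such that, writing $\mathcal I(X,E)=\mathrm{Lip}_0(X,E)\cap\mathcal I$ for a pointed metric space $X$ and a Banach space $E$: (i) $\mathcal I(X,E)$ is a linear subspace of $\mathrm{Lip}_0(X,E)$, $(\mathcal I(X,E),\|\cdot\|_{\mathcal I})$ is a Banach space, and $\mathrm{Lip}(f)\le\|f\|_{\mathcal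 I}$ for all $f\in\mathcal I(X,E)$; (ii) $Id_{\mathbb R}\in\mathcal I(\mathbb R,\mathbb R)$ and $\|Id_{\mathbb R}\|_{\mathcal I}=1$; (iii) if $g\in\mathrm{Lip}_0(Y,X)$, $f\in\mathcal I(X,E)$ and $S\in\mathcal L(E,F)$, then $S\circ f\circ g\in\mathcal I(Y,F)$ and $\|S\circ f\circ g\|_{\mathcal I}\le \mathrm{Lip}(g)\,\|f\|_{\mathcal I}\,\|S\|$. $\mathcal I\cap\mathcal L$ denotes the class of bounded linear operators between Banach spaces that belong to $\mathcal I$, with the norm $\|\cdot\|_{\mathcal I}$; its components are $\mathcal I\cap\mathcal L(E,F)$. It is a Banach (linear) operator ideal. Maximal hull: $f\in \mathrm{Lip}_0(X,E)$ belongs to $\mathcal I^{\max}(X,E)$ if $\|f\|_{\mathcal I^{\max}}:=\sup\|Q\circ f\circ\iota\|_{\mathcal I(X_0,E/M)}<\infty$, the supremum being over all finite metric subspaces $X_0\subset X$ (containing $0$) and all (closed) cofinite-dimensional subspaces $M$ of $E$, where $\iota\colon X_0\to X$ is the inclusion and $Q\colon E\to E/M$ the quotient map. $\mathcal I$ is maximal if $\mathcal I=\mathcal I^{\max}$ with equal norms. Translations: for $X\subset E$ with $0\in X$, $x_0\in X$ and $f\colon X\to F$, put $X-x_0=\{x-x_0\colon x\in X\}$ and $f^{x_0}\colon X-x_0\to F$, $f^{x_0}(z)=f(z+x_0)-f(x_0)$. $\mathcal I$ is invariant under translations if for all Banach spaces $E,F$, every subset $X\subset E$ with $0\in X$, every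 $x_0\in X$ and every Lipschitz map $f\colon X\to F$ with $f(0)=0$, one has $f\in\mathcal I(X,F)$ if and only if $f^{x_0}\in\mathcal I(X-x_0,F)$, with $\|f\|_{\mathcal I}=\|f^{x_0}\|_{\mathcal I}$. *)

(* Defs.v *)
From HB Require Import structures.
From mathcomp Require Import all_boot all_order all_algebra.
From mathcomp Require Import all_classical all_reals all_analysis.
Set Implicit Arguments.
Unset Strict Implicit.
Unset Printing Implicit Defensive.
Import Order.TTheory GRing.Theory Num.Theory.
Import numFieldNormedType.Exports.
Local Open Scope classical_set_scope.
Local Open Scope ring_scope.

Definition subspace_type (R : realType) (E : normedModType R)
  (M : submodClosed E) := {x : E | x \in M}.

Section subspace.
Context (R : realType) (E : normedModType R) (M : submodClosed E).
Local Notation S := (subspace_type M).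

HB.instance Definition _ := SubChoice.on S.
HB.instance Definition _ := [SubChoice_isSubLmodule of S by <:].

Definition subspace_norm (x : S) : R := `|val x|.

Let subspace_normD x y :
  subspace_norm (x + y) <= subspace_norm x + subspace_norm y.
Proof. by rewrite /subspace_norm raddfD; exact: ler_normD. Qed.

Let subspace_normZ (a : R) x : subspace_norm (a *: x) = `|a| * subspace_norm x.
Proof. by rewrite /subspace_norm linearZ normrZ. Qed.

Let subspace_norm0_eq0 x : subspace_norm x = 0 -> x = 0.
Proof. by move/normr0_eq0 => x0; apply: val_inj; rewrite x0 raddf0. Qed.

HB.instance Definition _ := @Lmodule_isNormed.Build R S subspace_norm
  subspace_normD subspace_normZ subspace_norm0_eq0.
End subspace.

Section bounded_operators.
Context (R : realType) (E F : normedModType R).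

Definition bounded_linear : {pred (E -> F)} := fun T : E -> F =>
  `[< linear T /\ exists C : R, forall x, `|T x| <= C * `|x| >].

Definition blin := {T : E -> F | T \in bounded_linear}.

Lemma bounded_linear_submod_closed : submod_closed bounded_linear.
Proof.
split.
  apply/asboolP; split; first by move=> a x y /=; rewrite scaler0 addr0.
  by exists 0 => x; rewrite normr0 mul0r.
move=> a S T /asboolP[lS [C SC]] /asboolP[lT [D TD]]; apply/asboolP; split.
  move=> b x y; rewrite /= !fctE lS lT !scalerDr addrACA; congr (_ + _).
  by congr (_ + _); rewrite !scalerA mulrC.
exists (`|a| * C + D) => x; rewrite !fctE (le_trans (ler_normD _ _))// mulrDl.
by rewrite lerD// normrZ -mulrA ler_wpM2l.
Qed.

HB.instance Definition _ :=
  GRing.isSubmodClosed.Build R (E -> F) bounded_linear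
    bounded_linear_submod_closed.
HB.instance Definition _ := SubChoice.on blin.
HB.instance Definition _ := [SubChoice_isSubLmodule of blin by <:].

Definition blin_fun (T : blin) : E -> F := val T.
Coercion blin_fun : blin >-> Funclass.

Definition opnorm (T : E -> F) : R :=
  sup [set `|T x| | x in [set x | `|x| <= 1]].

Lemma blin_linear (T : blin) : linear T.
Proof. by have /asboolP[] := valP T. Qed.

Lemma blin_bounded (T : blin) : exists2 C, 0 <= C & forall x, `|T x| <= C * `|x|.
Proof.
have /asboolP[_ [C TC]] := valP T; exists `|C| => // x.
by rewrite (le_trans (TC x))// ler_wpM2r// ler_norm.
Qed.

Lemma blinD (S T : blin) x : (S + T : blin) x = S x + T x.
Proof. by []. Qed.

Lemma blinZ (a : R) (T : blin) x : (a *: T : blin) x = a *: T x.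
Proof. by []. Qed.

Lemma blin0 (T : blin) : T 0 = 0.
Proof. by have := blin_linear T (- 1) 0 0; rewrite scaler0 addr0 scaleN1r addNr. Qed.

Lemma blinP (S T : blin) : S =1 T -> S = T.
Proof. by move=> ST; apply: val_inj; exact/funext. Qed.

Lemma opnorm_has_sup (T : blin) :
  has_sup [set `|T x| | x in [set x | `|x| <= 1]].
Proof.
split; first by exists `|T 0|, 0 => //=; rewrite normr0.
have [C C0 TC] := blin_bounded T.
exists C => _ [x /= x1 <-]; rewrite (le_trans (TC x))//.
by rewrite -[leRHS]mulr1 ler_wpM2l.
Qed.

Lemma opnorm_ge0 (T : blin) : 0 <= opnorm T.
Proof.
apply: (@le_trans _ _ `|T 0|) => //.
apply: sup_upper_bound; first exact: opnorm_has_sup.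
by exists 0 => //=; rewrite normr0.
Qed.

Lemma ler_opnorm (T : blin) x : `|T x| <= opnorm T * `|x|.
Proof.
have [->|x0] := eqVneq x 0; first by rewrite blin0 !normr0 mulr0.
have nx0 : 0 < `|x| by rewrite normr_gt0.
rewrite -ler_pdivrMr//.
suff -> : `|T x| / `|x| = `|T (`|x|^-1 *: x)|.
  apply: sup_upper_bound; first exact: opnorm_has_sup.
  by exists (`|x|^-1 *: x) => //=; rewrite normrZ normfV normr_id mulVf ?gt_eqF.
have := blin_linear T (`|x|^-1) x 0; rewrite addr0 blin0 addr0 => ->.
by rewrite normrZ normfV normr_id mulrC.
Qed.

Lemma opnorm_le (T : blin) C :
  0 <= C -> (forall x, `|T x| <= C * `|x|) -> opnorm T <= C.
Proof.
move=> C0 TC; apply: ge_sup; first by case: (opnorm_has_sup T).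
move=> _ [x /= x1 <-]; rewrite (le_trans (TC x))//.
by rewrite -[leRHS]mulr1 ler_wpM2l.
Qed.

Let blin_norm (T : blin) : R := opnorm T.

Let blin_normD S T : blin_norm (S + T) <= blin_norm S + blin_norm T.
Proof.
apply: opnorm_le => [|x]; first by rewrite addr_ge0 ?opnorm_ge0.
by rewrite blinD (le_trans (ler_normD _ _))// mulrDl lerD ?ler_opnorm.
Qed.

Let blin_normZ (a : R) T : blin_norm (a *: T) = `|a| * blin_norm T.
Proof.
have H b U : blin_norm (b *: U) <= `|b| * blin_norm U.
  apply: opnorm_le => [|x]; first by rewrite mulr_ge0 ?opnorm_ge0.
  by rewrite blinZ normrZ -mulrA ler_wpM2l ?ler_opnorm.
apply/eqP; rewrite eq_le H /=.
have [->|a0] := eqVneq a 0; first by rewrite normr0 mul0r opnorm_ge0.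
by rewrite -ler_pdivlMl ?normr_gt0// -normfV -{1}(scalerK a0 T) H.
Qed.

Let blin_norm0_eq0 T : blin_norm T = 0 -> T = 0.
Proof.
move=> T0; apply: blinP => x; apply: normr0_eq0; apply/eqP.
rewrite eq_le normr_ge0 andbT (le_trans (ler_opnorm T x))//.
by rewrite -[opnorm T]/(blin_norm T) T0 mul0r.
Qed.

HB.instance Definition _ := @Lmodule_isNormed.Build R blin blin_norm
  blin_normD blin_normZ blin_norm0_eq0.

Lemma blin_normE (T : blin) : `|T| = opnorm T. Proof. by []. Qed.

End bounded_operators.
Arguments bounded_linear {R} E F.

Section bounded_operators_complete.
Context (R : realType) (E : normedModType R) (F : completeNormedModType R).

Lemma blin_complete (G : set_system (blin E F)) :
  ProperFilter G -> cauchy G -> cvg G.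
Proof.
move=> PG /cauchyP cauG.
have cG (e : R) : 0 < e -> exists T : blin E F, G (ball T e) by exact: cauG.
have cvx (x : E) : cvg ((fun T : blin E F => T x) @ G).
  apply/cauchy_cvgP/cauchyP => e e0.
  have n0 : 0 < `|x| + 1 by rewrite ltr_wpDl.
  have [T GT] := cG (e / (`|x| + 1)) (divr_gt0 e0 n0).
  exists (T x); suff : G [set U : blin E F | ball (T x) e (U x)] by [].
  apply: filterS GT => U; rewrite -!ball_normE /= => TU.
  rewrite -[_ - _]/((T - U : blin E F) x).
  rewrite (le_lt_trans (ler_opnorm _ _))// -blin_normE.
  have : `|T - U| * (`|x| + 1) < e by rewrite -ltr_pdivlMr.
  by apply: le_lt_trans; rewrite ler_wpM2l// lerDl.
pose l (x : E) := lim ((fun T : blin E F => T x) @ G).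
have lcv x : (fun T : blin E F => T x) @ G --> l x by exact: cvx.
have llin : linear l.
  move=> a x y.
  have -> : l (a *: x + y) =
      lim ((fun T : blin E F => a *: T x + T y) @ G).
    by rewrite /l; congr (lim (_ @ G)); apply/funext => T; exact: blin_linear.
  apply: cvg_lim; first exact: norm_hausdorff.
  by apply: cvgD; [apply: cvgZr; exact: lcv|exact: lcv].
have lball e (T : blin E F) : 0 < e -> G (ball T e) ->
    forall x, `|T x - l x| <= e * `|x|.
  move=> e0 GT x.
  have h : (fun U : blin E F => `|T x - U x|) @ G --> `|T x - l x|.
    by apply: cvg_norm; apply: cvgB; [exact: cvg_cst|exact: lcv].
  rewrite -(cvg_lim (@Rhausdorff R) h); apply: limr_le; first exact: cvgP h.
  suff : G [set U : blin E F | `|T x - U x| <= e * `|x|] by [].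
  apply: filterS GT => U; rewrite -ball_normE /= => TU.
  rewrite -[_ - _]/((T - U : blin E F) x) (le_trans (ler_opnorm _ _))//.
  by rewrite -blin_normE ler_wpM2r// ltW.
have lbnd : l \in bounded_linear E F.
  apply/asboolP; split=> //.
  have [T GT] := cG 1 ltr01; exists (1 + opnorm T) => x.
  rewrite -(subrK (T x) (l x)) (le_trans (ler_normD _ _))// mulrDl.
  by rewrite lerD ?ler_opnorm// distrC lball.
pose L : blin E F := exist _ l lbnd.
apply/cvg_ex; exists L; apply/cvgrPdist_lt => e e0.
have e2 : 0 < e / 2 / 2 by rewrite !divr_gt0.
have [T GT] := cG _ e2; apply: filterS (GT) => U.
rewrite -ball_normE /= => TU.
rewrite -(subrKA T) (le_lt_trans (ler_normD _ _))// (splitr e) ltrD//.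
  rewrite (@le_lt_trans _ _ (e / 2 / 2))//; last first.
    by rewrite ltr_pdivrMr// ltr_pMr ?ltr1n// divr_gt0.
  rewrite blin_normE; apply: opnorm_le => [|x]; first exact: ltW.
  by rewrite -[_ x]/(l x - T x) distrC lball.
rewrite (lt_trans TU)// ltr_pdivrMr// ltr_pMr ?ltr1n// divr_gt0//.
Qed.

HB.instance Definition _ := Uniform_isComplete.Build (blin E F) blin_complete.

End bounded_operators_complete.

Section dual.
Context (R : realType).

Definition dual (E : normedModType R) : completeNormedModType R := blin E R.
Definition bidual (E : normedModType R) : completeNormedModType R :=
  dual (dual E).

Lemma evaluation_bounded_linear (E : normedModType R) (x : E) :
  (fun phi : blin E R => phi x) \in bounded_linear (blin E R) R.
Proof.
apply/asboolP; split; first by move=> a phi psi.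
by exists `|x| => phi; rewrite mulrC; exact: ler_opnorm.
Qed.

Definition bidual_embedding (E : normedModType R) (x : E) : bidual E :=
  exist _ (fun phi : blin E R => phi x) (evaluation_bounded_linear x).

End dual.

Lemma seq_complete (R : realType) (V : normedModType R) :
  (forall u : nat -> V, (forall n, `|u n.+1 - u n| <= (2 ^+ n)^-1) ->
     cvg (u @ \oo)) ->
  forall G : set_system V, ProperFilter G -> cauchy G -> cvg G.
Proof.
move=> Vcvg G PG /cauchyP cG.
pose eps n : R := (2 ^+ n)^-1 / 2.
have eps0 n : 0 < eps n by rewrite divr_gt0// invr_gt0 exprn_gt0.
have /choice[c cP] n : exists x, G (ball x (eps n)) by exact: cG.
have /choice[u uP] n : exists x, forall k, (k <= n)%N -> ball (c k) (eps k) x.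
  have : G [set x | forall k, (k <= n)%N -> ball (c k) (eps k) x].
    elim: n => [|n ih].
      by apply: filterS (cP 0%N) => x x0 k; rewrite leqn0 => /eqP->.
    apply: filterS2 ih (cP n.+1) => x xn xn1 k.
    by rewrite leq_eqVlt => /orP[/eqP->//|]; exact: xn.
  exact: filter_ex.
have ucv : cvg (u @ \oo).
  apply: Vcvg => n.
  have := uP n n (leqnn _); have := uP n.+1 n (leqnSn _).
  rewrite -!ball_normE /= => h1 h2.
  rewrite -(subrKA (c n)) (le_trans (ler_normD _ _))//.
  by rewrite [leRHS]splitr lerD// ltW// distrC.
have epscv : eps @ \oo --> 0.
  rewrite -(mul0r 2^-1); apply: cvgMl.
  have -> : (fun n => (2 ^+ n)^-1) = (fun n => 2^-1 ^+ n) :> (nat -> R).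
    by apply/funext => n; rewrite exprVn.
  by apply: cvg_expr; rewrite ger0_norm// invf_lt1// ltr1n.
apply/cvg_ex; exists (lim (u @ \oo)); apply/cvgrPdist_lt => e e0.
have e3 : 0 < e / 2 / 2 by rewrite !divr_gt0.
have : \forall n \near \oo, `|lim (u @ \oo) - u n| < e / 2 /\ `|eps n| < e / 2 / 2.
  have e2 : 0 < e / 2 by rewrite divr_gt0.
  near=> n; split; near: n.
    exact: cvgr_dist_lt ucv _ e2.
  exact: cvgr0_norm_lt epscv _ e3.
move=> /filter_ex[n [n1 n2]]; apply: filterS (cP n) => y.
have := uP n n (leqnn _); rewrite -!ball_normE /= => h1 h2.
rewrite -(subrKA (u n)) (le_lt_trans (ler_normD _ _))// (splitr e) ltrD//.
rewrite -(subrKA (c n)) (le_lt_trans (ler_normD _ _))// (splitr (e/2)).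
have en : eps n < e / 2 / 2 by rewrite (le_lt_trans (ler_norm _)).
by rewrite ltrD// ?(lt_trans h2)// distrC (lt_trans h1).
Unshelve. all: by end_near. Qed.

Record closed_subspace (R : realType) (E : normedModType R) := ClosedSubspace {
  closed_subspace_sub :> submodClosed E ;
  closed_subspaceP : closed [set x : E | x \in closed_subspace_sub] }.

Section quotient.
Context (R : realType) (E : normedModType R) (M : closed_subspace E).
Local Open Scope quotient_scope.

Definition closed_subspace_pred : {pred E} := M.

Let closed_subspace_zmod : zmod_closed closed_subspace_pred.
Proof. exact: GRing.submod_closedB (submodClosedP M). Qed.
HB.instance Definition _ :=
  GRing.isZmodClosed.Build E closed_subspace_pred closed_subspace_zmod.

Definition quotient := Quotient.quot closed_subspace_pred.
HB.instance Definition _ := GRing.Zmodule.on quotient.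
HB.instance Definition _ := EqQuotient.on quotient.

Definition quotient_map (x : E) : quotient := \pi_quotient x.

Lemma quotient_mapP x y : quotient_map x = quotient_map y <-> x - y \in (M : {pred E}).
Proof.
rewrite -[_ \in _]/(Quotient.equiv closed_subspace_pred x y).
by split=> [/eqmodP|h]; [|exact/eqmodP].
Qed.

Lemma quotient_mapD x y : quotient_map (x + y) = quotient_map x + quotient_map y.
Proof. exact: Quotient.pi_add. Qed.

Lemma quotient_map_repr (q : quotient) : quotient_map (repr q) = q.
Proof. exact: reprK. Qed.

Lemma quotient_map_surj (q : quotient) : exists x, quotient_map x = q.
Proof. by exists (repr q); exact: quotient_map_repr. Qed.

Definition quotient_scale (a : R) (q : quotient) : quotient :=
  quotient_map (a *: repr q).

Lemma quotient_mapZ a x : quotient_map (a *: x) = quotient_scale a (quotient_map x).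
Proof.
apply/quotient_mapP; rewrite -scalerBr; apply: rpredZ; apply/quotient_mapP.
by rewrite quotient_map_repr.
Qed.

Let quotient_scaleA a b q :
  quotient_scale a (quotient_scale b q) = quotient_scale (a * b) q.
Proof.
by have [x <-] := quotient_map_surj q; rewrite -!quotient_mapZ scalerA.
Qed.

Let quotient_scale1 : left_id 1 quotient_scale.
Proof.
by move=> q; have [x <-] := quotient_map_surj q; rewrite -quotient_mapZ scale1r.
Qed.

Let quotient_scaleDr : right_distributive quotient_scale +%R.
Proof.
move=> a p q; have [x <-] := quotient_map_surj p.
have [y <-] := quotient_map_surj q.
by rewrite -quotient_mapD -!quotient_mapZ -quotient_mapD scalerDr.
Qed.

Let quotient_scaleDl q : {morph quotient_scale^~ q : a b / a + b}.
Proof.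
move=> a b; have [x <-] := quotient_map_surj q.
by rewrite -!quotient_mapZ -quotient_mapD scalerDl.
Qed.

HB.instance Definition _ := GRing.Zmodule_isLmodule.Build R quotient
  quotient_scaleA quotient_scale1 quotient_scaleDr quotient_scaleDl.

Lemma quotient_map_linear : linear quotient_map.
Proof. by move=> a x y; rewrite quotient_mapD quotient_mapZ. Qed.

Lemma quotient_map0 : quotient_map 0 = 0.
Proof.
have := quotient_map_linear (- 1) 0 0.
by rewrite scaler0 addr0 scaleN1r addNr.
Qed.

Lemma quotient_mapN x : quotient_map (- x) = - quotient_map x.
Proof.
by have := quotient_map_linear (- 1) x 0; rewrite !addr0 quotient_map0 addr0 !scaleN1r.
Qed.

Definition quotient_norm (q : quotient) : R :=
  inf [set `|x| | x in [set x | quotient_map x = q]].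

Lemma quotient_has_inf q :
  has_inf [set `|x| | x in [set x | quotient_map x = q]].
Proof.
split; last by exists 0 => _ [x _ <-].
by have [x qx] := quotient_map_surj q; exists `|x|, x.
Qed.

Lemma quotient_norm_map x : quotient_norm (quotient_map x) <= `|x|.
Proof. by apply: ge_inf; [case: (quotient_has_inf (quotient_map x))|exists x]. Qed.

Lemma quotient_norm_ge0 q : 0 <= quotient_norm q.
Proof.
by apply: lb_le_inf => [|_ [x _ <-]//]; case: (quotient_has_inf q).
Qed.

Lemma quotient_norm_lt q e : quotient_norm q < e ->
  exists2 x, quotient_map x = q & `|x| < e.
Proof.
move=> /inf_lt[|_ [x qx <-]]; first by case: (quotient_has_inf q).
by exists x.
Qed.

Let quotient_normD p q :
  quotient_norm (p + q) <= quotient_norm p + quotient_norm q.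
Proof.
apply/ler_addgt0Pr => e e0; have e2 : 0 < e / 2 by rewrite divr_gt0.
have [|x px xe] := @quotient_norm_lt p (quotient_norm p + e / 2).
  by rewrite ltrDl.
have [|y qy ye] := @quotient_norm_lt q (quotient_norm q + e / 2).
  by rewrite ltrDl.
rewrite -px -qy -quotient_mapD (le_trans (quotient_norm_map _))//.
rewrite (le_trans (ler_normD _ _))// px qy (splitr e) addrACA.
by rewrite lerD// ltW.
Qed.

Let quotient_normZ (a : R) q :
  quotient_norm (a *: q) = `|a| * quotient_norm q.
Proof.
have H b p : quotient_norm (b *: p) <= `|b| * quotient_norm p.
  have [->|b0] := eqVneq b 0.
    rewrite scale0r normr0 mul0r -quotient_map0.
    by rewrite (le_trans (quotient_norm_map _))// normr0.
  rewrite -ler_pdivrMl ?normr_gt0//; apply: lb_le_inf.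
    by case: (quotient_has_inf p).
  move=> _ [x px <-]; rewrite ler_pdivrMl ?normr_gt0// -normrZ -px.
  by rewrite -[_ *: _]quotient_mapZ quotient_norm_map.
apply/eqP; rewrite eq_le H /=.
have [->|a0] := eqVneq a 0; first by rewrite normr0 mul0r quotient_norm_ge0.
by rewrite -ler_pdivlMl ?normr_gt0// -normfV -{1}(scalerK a0 q) H.
Qed.

Let quotient_norm0_eq0 q : quotient_norm q = 0 -> q = 0.
Proof.
have [x <-] := quotient_map_surj q => x0; rewrite -quotient_map0.
apply/quotient_mapP; rewrite subr0.
suff : closure [set x | x \in (M : {pred E})] x by exact: closed_subspaceP.
move=> B /nbhs_ballP[e /= e0 eB].
have [|y xy ye] := @quotient_norm_lt (quotient_map x) e; first by rewrite x0.
exists (x - y); split; first by apply/quotient_mapP; rewrite xy.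
by apply: eB; rewrite -ball_normE /= opprB addrC subrK.
Qed.

HB.instance Definition _ := @Lmodule_isNormed.Build R quotient quotient_norm
  quotient_normD quotient_normZ quotient_norm0_eq0.

Lemma quotient_normE (q : quotient) : `|q| = quotient_norm q. Proof. by []. Qed.

End quotient.

Section quotient_complete.
Context (R : realType) (E : completeNormedModType R) (M : closed_subspace E).

Lemma quotient_complete (G : set_system (quotient M)) :
  ProperFilter G -> cauchy G -> cvg G.
Proof.
apply: seq_complete => u uP.
have step (x : E) n : quotient_map M x = u n ->
    exists y, quotient_map M y = u n.+1 /\ `|y - x| <= 2 * 2^-1 ^+ n.
  move=> xn; have [|z zP zn] := @quotient_norm_lt _ _ M (u n.+1 - u n) (2 * 2^-1 ^+ n).
    by rewrite -quotient_normE (le_lt_trans (uP n))// exprVn ltr_pMl ?ltr1n.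
  exists (z + x); split; last by rewrite addrK ltW.
  by rewrite quotient_mapD zP xn subrK.
have [x0 x0P] := quotient_map_surj (u 0%N).
have /choice[g gP] (p : nat * E) : exists y, quotient_map M p.2 = u p.1 ->
    quotient_map M y = u p.1.+1 /\ `|y - p.2| <= 2 * 2^-1 ^+ p.1.
  have [h|h] := pselect (quotient_map M p.2 = u p.1); last by exists 0.
  by have [y yP] := step _ _ h; exists y.
pose x := fix x n := if n is m.+1 then g (m, x m) else x0.
have xP n : quotient_map M (x n) = u n.
  by elim: n => [//|n ih]; have [] := gP (n, x n) ih.
have xS n : `|x n.+1 - x n| <= 2 * 2^-1 ^+ n by have [] := gP (n, x n) (xP n).
have xcv : cvg (x @ \oo).
  have h : cvg (series (telescope x) @ \oo).
    apply: normed_cvg; apply: (@series_le_cvg _ _ (geometric 2 2^-1)) => [n|n|n|].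
    - exact: normr_ge0.
    - by rewrite /geometric /= mulr_ge0 ?exprn_ge0 ?invr_ge0 ?ler0n.
    - exact: xS.
    - by apply: is_cvg_geometric_series; rewrite ger0_norm// invf_lt1// ltr1n.
  have -> : x = (fun n => series (telescope x) n + x 0%N).
    by apply/funext => n; rewrite addrC; exact: eq_sum_telescope.
  by apply: is_cvgD => //; exact: is_cvg_cst.
apply/cvg_ex; exists (quotient_map M (lim (x @ \oo))).
apply/cvgrPdist_lt => e e0; near=> n.
rewrite -xP -quotient_mapN -quotient_mapD (le_lt_trans (quotient_norm_map _ _))//.
by near: n; exact: cvgr_dist_lt xcv _ e0.
Unshelve. all: by end_near. Qed.

HB.instance Definition _ :=
  Uniform_isComplete.Build (quotient M) quotient_complete.
End quotient_complete.

(* The distinguished point is a separate field: the [point] of a normed module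
   need not be its zero. *)
Record pointed_metric (R : realType) := PointedMetric {
  pm_space :> metricType R ;
  pm_base : pm_space }.

Section set_metric.
Context (R : realType) (X : metricType R) (A : set X).

Definition set_mdist (x y : A) : R := mdist (val x) (val y).

Let set_mdist_ge0 x y : 0 <= set_mdist x y.
Proof. exact: mdist_ge0. Qed.

Let set_mdist_positivity x y : set_mdist x y = 0 -> x = y.
Proof. by move=> /mdist_positivity/val_inj. Qed.

Let ballE_set_mdist (x : A) d : ball x d = [set y | set_mdist x y < d].
Proof.
rewrite -[LHS]/(val @^-1` ball (val x) d).
by rewrite ballEmdist.
Qed.

HB.instance Definition _ := PseudoMetric_isMetric.Build R A
  set_mdist_ge0 set_mdist_positivity ballE_set_mdist.
End set_metric.

Section normed_metric.
Context (R : realType) (E : normedModType R).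

Definition normed_metric : Type := E.
HB.instance Definition _ := PseudoMetric.on normed_metric.

Definition normed_mdist (x y : normed_metric) : R := `|(x : E) - (y : E)|.

Let normed_mdist_ge0 x y : 0 <= normed_mdist x y.
Proof. exact: normr_ge0. Qed.

Let normed_mdist_positivity x y : normed_mdist x y = 0 -> x = y.
Proof. by move=> /normr0_eq0/subr0_eq. Qed.

Let ballE_normed_mdist (x : normed_metric) d :
  ball x d = [set y | normed_mdist x y < d].
Proof. by rewrite -[LHS]/(@ball R E x d) -ball_normE. Qed.

HB.instance Definition _ := PseudoMetric_isMetric.Build R normed_metric
  normed_mdist_ge0 normed_mdist_positivity ballE_normed_mdist.
End normed_metric.

Definition pm_normed (R : realType) (E : normedModType R) : pointed_metric R :=
  @PointedMetric R (normed_metric E) (0 : E).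

Definition pm_sub (R : realType) (X : pointed_metric R) (A : set X)
    (A0 : A (pm_base X)) : pointed_metric R :=
  @PointedMetric R A (exist _ (pm_base X) (mem_set A0)).

Section lipschitz.
Context (R : realType) (X Y : metricType R).

Definition lipschitz_with (k : R) (f : X -> Y) :=
  forall x y, mdist (f x) (f y) <= k * mdist x y.

Definition lipschitz_map (f : X -> Y) := exists k, lipschitz_with k f.

Definition Lip (f : X -> Y) : R := inf [set k | 0 <= k /\ lipschitz_with k f].
End lipschitz.

Definition Lip0 (R : realType) (X Y : pointed_metric R) (f : X -> Y) :=
  lipschitz_map f /\ f (pm_base X) = pm_base Y.

(* Values of [lnorm] outside of [lmem] are meaningless. *)
Record lip_class (R : realType) := LipClass {
  lmem : forall (X : pointed_metric R) (E : completeNormedModType R),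
    set (X -> E) ;
  lnorm : forall (X : pointed_metric R) (E : completeNormedModType R),
    (X -> E) -> R }.
Arguments lmem {R} _ X E _.
Arguments lnorm {R} _ X E _.

Record banach_lip_ideal (R : realType) (I : lip_class R) : Prop := {
  bli_lip0 : forall (X : pointed_metric R) (E : completeNormedModType R)
    (f : X -> E),
    lmem I X E f -> @Lip0 R X (pm_normed E) f ;
  bli_0 : forall (X : pointed_metric R) (E : completeNormedModType R),
    lmem I X E (fun=> 0) ;
  bli_D : forall (X : pointed_metric R) (E : completeNormedModType R)
    (f g : X -> E), lmem I X E f -> lmem I X E g ->
    lmem I X E (fun x => f x + g x) ;
  bli_Z : forall (X : pointed_metric R) (E : completeNormedModType R)
    (a : R) (f : X -> E), lmem I X E f ->
    lmem I X E (fun x => a *: f x) ;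
  bli_norm_ge0 : forall (X : pointed_metric R) (E : completeNormedModType R)
    (f : X -> E), lmem I X E f -> 0 <= lnorm I X E f ;
  bli_norm_eq0 : forall (X : pointed_metric R) (E : completeNormedModType R)
    (f : X -> E), lmem I X E f ->
    lnorm I X E f = 0 -> f = (fun=> 0) ;
  bli_normD : forall (X : pointed_metric R) (E : completeNormedModType R)
    (f g : X -> E), lmem I X E f -> lmem I X E g ->
    lnorm I X E (fun x => f x + g x) <= lnorm I X E f + lnorm I X E g ;
  bli_normZ : forall (X : pointed_metric R) (E : completeNormedModType R)
    (a : R) (f : X -> E), lmem I X E f ->
    lnorm I X E (fun x => a *: f x) = `|a| * lnorm I X E f ;
  bli_complete : forall (X : pointed_metric R) (E : completeNormedModType R)
    (u : nat -> X -> E), (forall n, lmem I X E (u n)) ->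
    (forall e : R, 0 < e -> exists N : nat, forall m n : nat,
       (N <= m)%N -> (N <= n)%N -> lnorm I X E (fun x => u m x - u n x) < e) ->
    exists2 f, lmem I X E f &
      (fun n => lnorm I X E (fun x => u n x - f x)) @ \oo --> (0 : R) ;
  bli_Lip_le : forall (X : pointed_metric R) (E : completeNormedModType R)
    (f : X -> E), lmem I X E f ->
    @Lip R X (pm_normed E) f <= lnorm I X E f ;
  bli_id : lmem I (pm_normed R) R id /\ lnorm I (pm_normed R) R id = 1 ;
  bli_comp : forall (Y X : pointed_metric R) (E F : completeNormedModType R)
    (g : Y -> X) (f : X -> E) (S : blin E F), Lip0 g -> lmem I X E f ->
    lmem I Y F (S \o f \o g) /\
    lnorm I Y F (S \o f \o g) <= Lip g * lnorm I X E f * `|S| }.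

(* The norm of the class, with the value +oo outside of it. *)
Definition lenorm (R : realType) (I : lip_class R)
    (X : pointed_metric R) (E : completeNormedModType R)
    (f : X -> E) : \bar R :=
  if `[< lmem I X E f >] then (lnorm I X E f)%:E else +oo%E.

Definition finite_codimensional (R : realType) (E : normedModType R)
    (M : submodClosed E) :=
  exists (n : nat) (e : 'I_n -> E), forall x, exists c : 'I_n -> R,
    x - \sum_(i < n) c i *: e i \in M.

Definition max_enorm (R : realType) (I : lip_class R)
    (X : pointed_metric R) (E : completeNormedModType R) (f : X -> E) : \bar R :=
  ereal_sup [set a | exists (X0 : set X) (X00 : X0 (pm_base X))
      (M : closed_subspace E),
    [/\ finite_set X0, finite_codimensional M &
        a = @lenorm R I (pm_sub X00) (quotient M)
              (quotient_map M \o f \o val)]].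

Definition max_hull (R : realType) (I : lip_class R) : lip_class R := {|
  lmem := fun X E => [set f | @Lip0 R X (pm_normed E) f /\
                              (max_enorm I f < +oo)%E] ;
  lnorm := fun X E f => fine (max_enorm I f) |}.

Definition maximal_lip_ideal (R : realType) (I : lip_class R) :=
  forall (X : pointed_metric R) (E : completeNormedModType R)
    (f : X -> E),
    (lmem I X E f <-> lmem (max_hull I) X E f) /\
    (lmem I X E f -> lnorm I X E f = lnorm (max_hull I) X E f).

Section translation.
Context (R : realType) (E : normedModType R) (X : set E).

Definition translated_set (x0 : X) : set E := [set x - val x0 | x in X].

Lemma translated_setP (x0 : X) (z : translated_set x0) :
  X (val z + val x0).
Proof. by have [x Xx <-] := set_mem (valP z); rewrite subrK. Qed.

Lemma translated_set0 (x0 : X) : translated_set x0 0.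
Proof. by exists (val x0); [exact: set_mem (valP x0)|rewrite subrr]. Qed.

Definition translated_map (F : zmodType) (x0 : X) (f : X -> F)
    (z : translated_set x0) : F :=
  f (exist _ (val z + val x0) (mem_set (translated_setP z))) - f x0.
End translation.

Definition translation_invariant (R : realType) (I : lip_class R) :=
  forall (E F : completeNormedModType R) (X : set E) (X0 : X 0) (x0 : X)
    (f : X -> F),
  let pX := @pm_sub R (pm_normed E) X X0 in
  let pXx0 := @pm_sub R (pm_normed E) (translated_set x0) (translated_set0 x0) in
  @Lip0 R pX (pm_normed F) f ->
  (lmem I pX F f <-> lmem I pXx0 F (@translated_map _ _ _ _ x0 f)) /\
  (lmem I pX F f -> lnorm I pX F f = lnorm I pXx0 F (translated_map f)).

(* Main.v *)
Require Import Defs.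
From mathcomp Require Import all_boot all_order all_algebra.
From mathcomp Require Import all_classical all_reals all_analysis.
From mathcomp Require Import ring lra.

(* The ideal allows differences [f (x + w) - f w] and convex combinations of them without
   increasing the norm of [f]. Regarded as maps into [F''] with the weak* topology they
   form a relatively compact convex set, on which the translations by elements of [E0],
   and then by all of [E], act affinely and commute; a Markov-Kakutani argument yields
   first a limit [c] with [c (x + a) = c x + T a] for [a] in [E0], and then an additive,
   hence linear, operator [R : E -> F''] extending [T].
   As the maximal hull tests [R] against quotients of [F''] by arbitrary closed
   finite-codimensional subspaces, which need not be weak* closed, the quotient map is
   replaced, on a finite set, by the biadjoint of an operator on [F] (local
   reflexivity). *)

Set Implicit Arguments.
Unset Strict Implicit.
Unset Printing Implicit Defensive.
Import Order.TTheory GRing.Theory Num.Theory.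
Import numFieldNormedType.Exports.
Local Open Scope classical_set_scope.
Local Open Scope ring_scope.

(** * Sublinear functionals and the Hahn-Banach theorem *)

Section linear_functions.
Context (R : realType) (V W : lmodType R) (f : V -> W) (linf : linear f).

Lemma linear_mapB x y : f (x - y) = f x - f y.
Proof. exact: zmod_morphism_linear linf x y. Qed.

Lemma linear_map0 : f 0 = 0.
Proof. by have := linear_mapB 0 0; rewrite !subrr. Qed.

Lemma linear_mapN x : f (- x) = - f x.
Proof. by have := linear_mapB 0 x; rewrite linear_map0 !sub0r. Qed.

Lemma linear_mapD x y : f (x + y) = f x + f y.
Proof. by have := linf 1 x y; rewrite !scale1r. Qed.

Lemma linear_mapZ a x : f (a *: x) = a *: f x.
Proof. exact: scalable_linear linf a x. Qed.

Lemma linear_sumZ (n : nat) (c : 'I_n -> R) (x : 'I_n -> V) :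
  f (\sum_i c i *: x i) = \sum_i c i *: f (x i).
Proof.
by elim/big_rec2 : _ => [|i v u _ <-]; [exact: linear_map0|exact: linf].
Qed.
End linear_functions.

Definition sublinear (R : realType) (Z : lmodType R) (p : Z -> R) :=
  (forall x y, p (x + y) <= p x + p y) /\
  (forall a x, 0 <= a -> p (a *: x) = a * p x).

Lemma sublinear0 (R : realType) (Z : lmodType R) (p : Z -> R) :
  sublinear p -> p 0 = 0.
Proof. by case=> _ /(_ 0 0 (lexx _)); rewrite scale0r mul0r. Qed.

Lemma sublinear_geN (R : realType) (Z : lmodType R) (p : Z -> R) (x : Z) :
  sublinear p -> - p (- x) <= p x.
Proof.
move=> sp; have := sp.1 x (- x).
by rewrite subrr (sublinear0 sp) => h; lra.
Qed.

Lemma sublinearP (R : realType) (Z : lmodType R) (p : Z -> R) :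
  (forall x y, p (x + y) <= p x + p y) -> p 0 = 0 ->
  (forall a x, 0 < a -> p (a *: x) <= a * p x) -> sublinear p.
Proof.
move=> pD p0 pZ; split=> // a x; rewrite le_eqVlt => /orP[/eqP<-|a0].
  by rewrite scale0r mul0r.
apply/eqP; rewrite eq_le pZ//= -ler_pdivlMl//.
by rewrite -{1}(scalerK (lt0r_neq0 a0) x) pZ// invr_gt0.
Qed.

(** Serves three infima: the shift by a vector, the infimum of a chain, and the quotient functional.
    The minorant [m] keeps each infimum finite; [m 0 = 0] and the index with [h d 0 <= 0] fix the
    value at [0]. *)
Lemma inf_sublinear (R : realType) (Z : lmodType R) (D : Type)
    (P : set D) (h : D -> Z -> R) (m : Z -> R) :
  P !=set0 -> (forall d x, P d -> m x <= h d x) ->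
  (forall d e x y, P d -> P e ->
    exists2 f, P f & h f (x + y) <= h d x + h e y) ->
  m 0 = 0 -> (exists2 d, P d & h d 0 <= 0) ->
  (forall a d x, 0 < a -> P d -> exists2 e, P e & h e (a *: x) <= a * h d x) ->
  sublinear (fun x => inf [set h d x | d in P]).
Proof.
move=> [d0 Pd0] hm hD m0 [d1 Pd1 hd1] hZ.
have lb x : has_lbound [set h d x | d in P].
  by exists (m x) => _ [d Pd <-]; exact: hm.
have ne x : [set h d x | d in P] !=set0 by exists (h d0 x), d0.
apply: sublinearP => [x y||a x a0].
- rewrite -lerBlDr; apply: lb_le_inf => // _ [d Pd <-].
  rewrite lerBlDr -lerBlDl; apply: lb_le_inf => // _ [e Pe <-].
  have [f Pf hf] := hD d e x y Pd Pe.
  rewrite lerBlDl (le_trans _ hf)//.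
  by apply: ge_inf => //; exists f.
- apply/eqP; rewrite eq_le; apply/andP; split.
    by apply: le_trans hd1; apply: ge_inf => //; exists d1.
  by apply: lb_le_inf => // _ [d Pd <-]; rewrite -m0 hm.
- rewrite -ler_pdivrMl//; apply: lb_le_inf => // _ [d Pd <-].
  rewrite ler_pdivrMl//; have [e Pe he] := hZ a d x a0 Pd.
  by apply: le_trans he; apply: ge_inf => //; exists e.
Qed.

(* The witness [x |-> inf_(l >= 0) (p (x + l t) - l p t)] shows that a minimal sublinear
   functional is odd. *)
Lemma sublinear_shift (R : realType) (Z : lmodType R) (p : Z -> R) (t : Z) :
  sublinear p ->
  exists q, [/\ sublinear q, forall x, q x <= p x & q (- t) <= - p t].
Proof.
move=> sp; have [pD pZ] := sp; have p0 := sublinear0 sp.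
pose h (l : R) (x : Z) := p (x + l *: t) - l * p t.
have hlb l x : 0 <= l -> - p (- x) <= h l x.
  move=> l0; have := pD (x + l *: t) (- x).
  by rewrite addrAC subrr add0r pZ// /h => ?; lra.
have lbh x : has_lbound [set h l x | l in [set l | 0 <= l]].
  by exists (- p (- x)) => _ [l l0 <-]; exact: hlb.
exists (fun x => inf [set h l x | l in [set l | 0 <= l]]); split.
- apply: (@inf_sublinear R Z _ [set l | 0 <= l] h (fun x => - p (- x))).
  + by exists 0 => /=.
  + by move=> l x; exact: hlb.
  + move=> l k x y l0 k0; exists (l + k); first exact: addr_ge0.
    rewrite /h scalerDl addrACA; have := pD (x + l *: t) (y + k *: t).
    by move=> ?; lra.
  + by rewrite oppr0 p0 oppr0.
  + by exists 0 => //=; rewrite /h scale0r addr0 p0 mul0r subr0.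
  + move=> a l x a0 l0; exists (a * l); first exact: mulr_ge0 (ltW a0) l0.
    by rewrite /h -scalerA -scalerDr pZ ?(ltW a0)// mulrBr mulrA.
- move=> x; apply: ge_inf => //; exists 0 => //=.
  by rewrite /h scale0r addr0 mul0r subr0.
- apply: ge_inf => //; exists 1 => //=.
  by rewrite /h scale1r addNr p0 mul1r sub0r.
Qed.

(** By Zorn's lemma: a chain is bounded below by its pointwise infimum, which is finite because
    every sublinear minorant of [p] lies above [- p (- x)]. *)
Lemma sublinear_minimal (R : realType) (Z : lmodType R) (p : Z -> R) :
  sublinear p ->
  exists q, [/\ sublinear q, forall x, q x <= p x &
    forall r, sublinear r -> (forall x, r x <= q x) -> r = q].
Proof.
move=> sp.
pose T := {q : Z -> R | sublinear q /\ forall x, q x <= p x}.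
have TP (q : T) : sublinear (sval q) /\ forall x, sval q x <= p x by case: q.
(* Reversed order: a maximal element for [rel] is a minimal functional. *)
pose rel (q r : T) : bool := `[< forall x, sval r x <= sval q x >].
have [t| | |A totA|[q [sq qp]] qmin] := @Zorn T rel.
- exact/asboolP.
- by move=> r s t /asboolP rs /asboolP st; apply/asboolP => x; exact: le_trans (rs x).
- move=> [s sP] [t tP] /asboolP /= st /asboolP /= ts; apply: eq_exist => /=.
  by apply/funext => x; apply: le_anti; rewrite st ts.
- have [->|/set0P A0] := eqVneq A set0.
    by exists (exist _ p (conj sp (fun=> lexx _))).
  have hlb (q : T) x : - p (- x) <= sval q x.
    have [sq qp] := TP q; apply: le_trans (sublinear_geN x sq).
    by rewrite lerN2.
  have lbA x : has_lbound [set sval q x | q in A].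
    by exists (- p (- x)) => _ [q _ <-].
  pose g x := inf [set sval q x | q in A].
  have sg : sublinear g.
    apply: (@inf_sublinear R Z T A (fun q => sval q) (fun x => - p (- x))) => //.
    + move=> q r x y Aq Ar.
      have [/asboolP qr|/asboolP rq] := totA _ _ Aq Ar.
        exists r => //; apply: le_trans ((TP r).1.1 x y) _.
        by rewrite lerD2r.
      exists q => //; apply: le_trans ((TP q).1.1 x y) _.
      by rewrite lerD2l.
    + by rewrite oppr0 (sublinear0 sp) oppr0.
    + by have [q Aq] := A0; exists q => //; rewrite (sublinear0 (TP q).1).
    + by move=> a q x a0 Aq; exists q => //; rewrite (TP q).1.2// ltW.
  have gq (q : T) x : A q -> g x <= sval q x.
    by move=> Aq; apply: ge_inf => //; exists q.
  have gp x : g x <= p x.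
    by have [q Aq] := A0; exact: le_trans (gq q x Aq) ((TP q).2 x).
  by exists (exist _ g (conj sg gp)) => q Aq; apply/asboolP => x; exact: gq.
exists q; split=> // r sr rq.
have rp x : r x <= p x by exact: le_trans (rq x) (qp x).
have /(_ _)/(congr1 sval) := qmin (exist _ r (conj sr rp)); apply.
exact/asboolP.
Qed.

(** A minimal sublinear functional is linear: its shift at [x] lies below it, hence equals it, which
    makes it odd, and oddness turns subadditivity into additivity. Minimising below the shift of [p]
    at [t] forces equality at [t]. *)
Lemma hahn_banach (R : realType) (Z : lmodType R) (p : Z -> R) (t : Z) :
  sublinear p ->
  exists l : Z -> R, [/\ linear (l : Z -> R^o), forall x, l x <= p x & l t = p t].
Proof.
move=> sp; have [q [sq qp qt]] := sublinear_shift t sp.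
have [l [sl lq lmin]] := sublinear_minimal sq.
have lN x : l (- x) = - l x.
  have [r [sr rl rx]] := sublinear_shift x sl.
  apply/eqP; rewrite eq_le -{1}(lmin r sr rl) rx /=.
  by rewrite lerNl (le_trans _ (sublinear_geN x sl))// opprK.
have lD x y : l (x + y) = l x + l y.
  apply/eqP; rewrite eq_le sl.1 /= -lerN2 -lN !opprD.
  by rewrite (le_trans (sl.1 _ _))// !lN.
have lZ a x : l (a *: x) = a * l x.
  have [a0|a0] := leP 0 a; first exact: sl.2.
  by rewrite -[a]opprK scaleNr lN sl.2 ?oppr_ge0 ?ltW// opprK mulNr opprK.
exists l; split.
- by move=> a x y; rewrite lD lZ.
- by move=> x; exact: le_trans (lq x) (qp x).
- apply/eqP; rewrite eq_le (le_trans (lq t) (qp t)) /=.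
  by rewrite -lerN2 -lN (le_trans (lq _)).
Qed.

(** Hahn-Banach for the quotient functional [inf_v p (x - L v)]. The result is nonpositive on the
    range of [L], a subspace, hence vanishes there. *)
Lemma hahn_banach_annihilator (R : realType) (V Z : lmodType R) (p : Z -> R)
    (L : V -> Z) (c : R) (t : Z) :
  sublinear p -> (forall x, 0 <= p x) -> linear L ->
  (forall v, c <= p (t - L v)) ->
  exists l : Z -> R, [/\ linear (l : Z -> R^o), forall x, l x <= p x,
    forall v, l (L v) = 0 & c <= l t].
Proof.
move=> sp p_ge0 linL cp.
have L0 := linear_map0 linL.
have sq : sublinear (fun x => inf [set p (x - L v) | v in setT]).
  apply: (@inf_sublinear R Z V setT (fun v x => p (x - L v)) (fun=> 0)) => //.
  - by exists 0.
  - move=> v w x y _ _; exists (v + w) => //.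
    by rewrite (linear_mapD linL) opprD addrACA sp.1.
  - by exists 0 => //=; rewrite L0 subr0 (sublinear0 sp).
  - move=> a v x a0 _; exists (a *: v) => //=.
    by rewrite (linear_mapZ linL) -scalerBr sp.2 //; exact: ltW.
have lb x : has_lbound [set p (x - L v) | v in setT] by exists 0 => _ [v _ <-].
have [l [linl lq lt]] := hahn_banach t sq.
have lL v : l (L v) <= 0.
  apply: (le_trans (lq _)); rewrite -[leRHS](sublinear0 sp).
  by apply: ge_inf => //; exists v => //; rewrite subrr.
exists l; split=> //.
- move=> x; apply: (le_trans (lq _)); apply: ge_inf => //.
  by exists 0 => //; rewrite L0 subr0.
- move=> v; apply/eqP; rewrite eq_le lL /= -oppr_le0 -(linear_mapN linl).
  by rewrite -(linear_mapN linL) lL.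
- rewrite lt; apply: lb_le_inf; first by exists (p (t - L 0)), 0.
  by move=> _ [v _ <-].
Qed.

(** * Helly's theorem *)

Lemma blin_of_linear (R : realType) (E F : normedModType R) (l : E -> F) (C : R) :
  linear l -> 0 <= C -> (forall x, `|l x| <= C * `|x|) ->
  exists2 T : blin E F, `|T| <= C & forall x, T x = l x.
Proof.
move=> linl C0 lC.
have lP : l \in bounded_linear E F by apply/asboolP; split=> //; exists C.
pose T : blin E F := exist _ l lP.
by exists T => //; apply: (opnorm_le (T := T)).
Qed.

Lemma exists_norming_functional (R : realType) (Y : normedModType R) (y : Y) :
  exists2 phi : blin Y R, `|phi| <= 1 & phi y = `|y|.
Proof.
have sn : sublinear (fun x : Y => `|x|).
  by split=> [x z|a x a0]; [exact: ler_normD|rewrite normrZ ger0_norm].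
have [l [linl ln ly]] := hahn_banach y sn.
have [|//||phi phi1 phil] := @blin_of_linear R Y R l 1; last first.
- by exists phi => //; rewrite phil.
- move=> x; rewrite mul1r ler_norml ln andbT lerNl -[leRHS]normrN.
  by apply: le_trans (ln (- x)); rewrite (linear_mapN linl).
- exact: linl.
Qed.

Lemma opnorm_adherent (R : realType) (G : normedModType R) (eta : blin G R) (e : R) :
  0 < e -> exists2 u : G, `|u| <= 1 & `|eta| - e <= eta u.
Proof.
move=> e0; have [_ [u u1 <-] ue] := sup_adherent e0 (opnorm_has_sup eta).
have [h|h] := leP 0 (eta u).
  by exists u => //; move: ue; rewrite ger0_norm// => /ltW.
exists (- u); first by rewrite normrN.
rewrite (linear_mapN (blin_linear eta)).
by move: ue; rewrite ltr0_norm// => /ltW.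
Qed.

(** The [l_1] sum of the duals is the dual of the maximum norm on [N]-tuples: points [u k] that
    nearly norm the [eta k] can be chosen independently. *)
Lemma sum_opnorm_le (R : realType) (G : normedModType R) (N : nat)
    (eta : 'I_N -> blin G R) (C : R) :
  (forall u : 'I_N -> G, (forall k, `|u k| <= 1) -> \sum_k eta k (u k) <= C) ->
  \sum_k `|eta k| <= C.
Proof.
move=> etaC; apply/ler_addgt0Pr => e e0.
have e1 : 0 < e / N.+1%:R by rewrite divr_gt0.
have /choice[u uP] k : exists u, `|u| <= 1 /\ `|eta k| - e / N.+1%:R <= eta k u.
  by have [u] := opnorm_adherent (eta k) e1; exists u.
rewrite -lerBlDr; apply: le_trans (etaC u (fun k => (uP k).1)).
have : \sum_(k < N) (`|eta k| - e / N.+1%:R) <= \sum_k eta k (u k).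
  by apply: ler_sum => k _; exact: (uP k).2.
apply: le_trans; rewrite big_split /= lerD2l sumr_const card_ord.
rewrite mulNrn lerN2 -[leLHS]mulr_natr mulrAC ler_pdivrMr//.
by rewrite ler_wpM2l ?(ltW e0)// ler_nat.
Qed.

Lemma bigmax_norm_sublinear (R : realType) (G : normedModType R) (N : nat) :
  sublinear (fun u : 'I_N -> G => \big[Num.max/0]_k `|u k|).
Proof.
apply: sublinearP => [u v||a u a0].
- apply: bigmax_le => [|k _]; first by rewrite addr_ge0// bigmax_ge_id.
  rewrite (le_trans (ler_normD _ _))// lerD//;
    [exact: (le_bigmax _ (fun k => `|u k|))|exact: (le_bigmax _ (fun k => `|v k|))].
- by apply/eqP; rewrite eq_le bigmax_ge_id andbT bigmax_le// => k _; rewrite normr0.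
- apply: bigmax_le => [|k _]; first by rewrite mulr_ge0 ?(ltW a0)// bigmax_ge_id.
  rewrite normrZ gtr0_norm// ler_wpM2l ?(ltW a0)//.
  exact: (le_bigmax _ (fun k => `|u k|)).
Qed.

(** Helly's theorem for [m]-tuples [p], measured by [max_k |sum_j a k j p j|]. If no [p] works, then
    [(0, t)] stays away from the range of the linear map [L], and a functional separating them
    violates the duality hypothesis. *)
Lemma helly_approx (R : realType) (G : normedModType R) (N n m : nat)
    (a : 'I_N -> 'I_m -> R) (xi : 'I_n -> blin G R) (t : 'I_n -> 'I_m -> R) :
  (forall (eta : 'I_N -> blin G R) (b : 'I_n -> 'I_m -> R),
    (forall j g, \sum_k a k j * eta k g = \sum_i b i j * xi i g) ->
    \sum_i \sum_j b i j * t i j <= \sum_k `|eta k|) ->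
  forall d, 0 < d -> exists p : 'I_m -> G,
    (forall k, `|\sum_j a k j *: p j| <= 1 + d) /\
    (forall i j, `|xi i (p j) - t i j| <= d).
Proof.
move=> tP d d0; apply: contrapT => /forallNP noP.
pose Z := (('I_N -> G) * ('I_n -> 'I_m -> R^o))%type.
(* The weight for which [Phi (t - L p) < 1 + d] would make [p] satisfy the conclusion. *)
pose K := (1 + d) / d.
have K0 : 0 < K by rewrite divr_gt0// addr_gt0.
pose Phi (z : Z) := \big[Num.max/0]_k `|z.1 k| + K * \sum_i \sum_j `|z.2 i j|.
have sumge0 (s : 'I_n -> 'I_m -> R) : 0 <= \sum_i \sum_j `|s i j|.
  by apply: sumr_ge0 => i _; apply: sumr_ge0 => j _; exact: normr_ge0.
have [mD mZ] := bigmax_norm_sublinear G N.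
have sPhi : sublinear Phi.
  split=> [x y|c x c0]; rewrite /Phi.
    rewrite addrACA -mulrDr lerD//; first exact: mD.
    rewrite ler_wpM2l ?(ltW K0)// -big_split ler_sum// => i _.
    by rewrite -big_split ler_sum// => j _; exact: ler_normD.
  rewrite mulrDr -mZ//; congr (_ + _); rewrite mulrCA; congr (_ * _).
  rewrite mulr_sumr; apply: eq_bigr => i _.
  rewrite mulr_sumr; apply: eq_bigr => j _.
  by rewrite -[X in X * _](ger0_norm c0) -normrM.
have Phi0 z : 0 <= Phi z.
  by rewrite addr_ge0 ?bigmax_ge_id// mulr_ge0 ?(ltW K0).
pose L (p : 'I_m -> G) : Z :=
  (fun k => \sum_j a k j *: p j, fun i j => xi i (p j)).
have linL : linear L.
  move=> c p q; congr (_, _).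
    apply/funext => k.
    rewrite -[RHS]/(c *: (\sum_j a k j *: p j) + \sum_j a k j *: q j).
    rewrite scaler_sumr -big_split; apply: eq_bigr => j _.
    by rewrite !fctE scalerDr !scalerA mulrC.
  by apply/funext => i; apply/funext => j; exact: blin_linear.
(* Either some combination has norm above [1 + d], or some entry misses [t i j] by more than [d],
   which the weight [K] magnifies beyond [1 + d]. *)
have tL v : 1 + d <= Phi ((0, t) - L v).
  rewrite /Phi /=; have [h|] := pselect (forall k, `|\sum_j a k j *: v j| <= 1 + d).
    have /existsNP[i /existsNP[j /negP]] : ~ forall i j, `|xi i (v j) - t i j| <= d.
      by move=> h'; apply: (noP v).
    rewrite -ltNge => dt; rewrite ler_wpDl ?bigmax_ge_id//.
    rewrite -[leLHS](divfK (lt0r_neq0 d0)) -/K ler_wpM2l ?(ltW K0)//.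
    rewrite (bigD1 i)//= (bigD1 j)//= -addrA ler_wpDr//.
      by rewrite addr_ge0// ?sumr_ge0// => k _; rewrite sumr_ge0.
    by rewrite !fctE distrC ltW.
  move=> /existsNP[k /negP]; rewrite -ltNge => /ltW h.
  rewrite ler_wpDr//; first by apply: mulr_ge0; [exact: ltW|exact: sumge0].
  apply: (le_trans _ (le_bigmax _ (fun k => `|((0, t) - L v : Z).1 k|) k)).
  by rewrite -[X in _ <= `|X|]/(0 - \sum_j a k j *: v j) sub0r normrN.
have [l [linl lPhi lL lt]] := hahn_banach_annihilator sPhi Phi0 linL tL.
have l0 := linear_map0 linl.
have lD := linear_mapD linl.
have lZ c x : l (c *: x) = c * l x by exact: linear_mapZ linl c x.
pose l1 (u : 'I_N -> G) := l (u, 0).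
pose l2 (s : 'I_n -> 'I_m -> R^o) := l (0, s).
have lE u s : l (u, s) = l1 u + l2 s.
  by rewrite -lD; congr l; congr (_, _); rewrite /= ?addr0 ?add0r.
have l1D u v : l1 (u + v) = l1 u + l1 v.
  by rewrite -lD; congr l; congr (_, _); rewrite /= addr0.
have l2D s s' : l2 (s + s') = l2 s + l2 s'.
  by rewrite -lD; congr l; congr (_, _); rewrite /= addr0.
have l1Z c u : l1 (c *: u) = c * l1 u.
  by rewrite -lZ; congr l; congr (_, _); rewrite /= scaler0.
have l2Z c s : l2 (c *: s) = c * l2 s.
  by rewrite -lZ; congr l; congr (_, _); rewrite /= scaler0.
pose e1 k (u : G) : 'I_N -> G := fun k' => if k' == k then u else 0.
pose e2 i j : 'I_n -> 'I_m -> R^o := fun i' j' => ((i' == i) && (j' == j))%:R.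
have e1E (u : 'I_N -> G) : u = \sum_k e1 k (u k).
  apply/funext => k; rewrite fct_sumE (bigD1 k)//= /e1 eqxx big1 ?addr0// => i.
  by rewrite eq_sym => /negPf ->.
have e2E (s : 'I_n -> 'I_m -> R^o) : s = \sum_i \sum_j s i j *: e2 i j.
  apply/funext => i; apply/funext => j; rewrite fct_sumE fct_sumE (bigD1 i)//=.
  rewrite [X in _ + X]big1 ?addr0 => [|k ki].
    rewrite fct_sumE fct_sumE (bigD1 j)//= !fctE /e2 !eqxx big1.
      by rewrite addr0 -[RHS]/(_ * _) mulr1.
    by move=> k kj; rewrite !fctE [j == k]eq_sym (negPf kj) andbF scaler0.
  rewrite fct_sumE fct_sumE big1// => k' _.
  by rewrite !fctE /e2 [i == k]eq_sym (negPf ki) scaler0.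
have e1D k c u v : e1 k (c *: u + v) = c *: e1 k u + e1 k v.
  apply/funext => k'; rewrite -[RHS]/(c *: e1 k u k' + e1 k v k') /e1.
  by case: ifP => // _; rewrite scaler0 addr0.
have le1 k : linear ((fun u => l1 (e1 k u)) : G -> R^o).
  by move=> c u v; rewrite e1D l1D l1Z.
have le1B k u : `|l1 (e1 k u)| <= 1 * `|u|.
  have h w : l1 (e1 k w) <= `|w|.
    apply: le_trans (lPhi _) _; rewrite /Phi /= [X in K * X]big1 => [|i _].
      rewrite mulr0 addr0 bigmax_le// => k' _; rewrite /e1.
      by case: ifP => // _; rewrite normr0.
    by rewrite big1// => j _; rewrite normr0.
  rewrite mul1r ler_norml h andbT lerNl -[`|u|]normrN; apply: le_trans (h (- u)).
  by rewrite (linear_mapN (le1 k)).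
have /choice[eta etaP] k : exists T : blin G R, forall x, T x = l1 (e1 k x).
  by have [T _ TE] := @blin_of_linear R G R _ 1 (le1 k) ler01 (le1B k); exists T.
pose b i j := l2 (e2 i j).
have {}lE u s : l (u, s) = \sum_k eta k (u k) + \sum_i \sum_j b i j * s i j.
  rewrite lE {1}(e1E u) {1}(e2E s) (big_morph l1 l1D l0); congr (_ + _).
    by apply: eq_bigr => k _; rewrite etaP.
  rewrite (big_morph l2 l2D l0); apply: eq_bigr => i _.
  rewrite (big_morph l2 l2D l0); apply: eq_bigr => j _.
  by rewrite l2Z mulrC.
have lL0 p : \sum_k eta k (\sum_j a k j *: p j) + \sum_i \sum_j b i j * xi i (p j) = 0.
  by rewrite -(lE _ (fun i j => xi i (p j))) lL.
have etaB : \sum_k `|- eta k| <= 1.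
  under eq_bigr do rewrite normrN.
  apply: sum_opnorm_le => u u1.
  have := lPhi (u, 0); rewrite lE [X in _ + X]big1 ?addr0; last first.
    by move=> i _; rewrite big1// => j _; rewrite mulr0.
  move=> /le_trans; apply; rewrite /Phi /= [X in K * X]big1 => [|i _].
    by rewrite mulr0 addr0 bigmax_le.
  by rewrite big1// => j _; rewrite normr0.
(* Vanishing on the range of [L] relates the [eta k] to the [b i j] with opposite signs, so the
   hypothesis is applied to [- eta]. *)
have : \sum_i \sum_j b i j * t i j <= \sum_k `|- eta k|.
  apply: tP => j g.
  have := lL0 (fun j' => if j' == j then g else 0).
  under eq_bigr => k _.
    rewrite (bigD1 j)//= eqxx big1 ?addr0 => [|j' /negPf->]; last by rewrite scaler0.
    over.
  under [X in _ + X]eq_bigr => i _.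
    rewrite (bigD1 j)//= eqxx big1 ?addr0 => [|j' /negPf->]; last by rewrite blin0 mulr0.
    over.
  move=> /eqP; rewrite addr_eq0 => /eqP h; apply: oppr_inj; rewrite -h -sumrN.
  apply: eq_bigr => k _.
  rewrite (linear_mapZ (blin_linear (eta k))).
  by rewrite -[LHS]/(- (a k j * - eta k g)) mulrN opprK.
move=> /le_trans /(_ etaB) b1; move: lt; rewrite lE [X in _ <= X + _]big1 ?add0r.
  by move=> /le_trans /(_ b1); rewrite -lerBrDl subrr leNgt d0.
by move=> k _; exact: blin0.
Qed.

(** * Finite-dimensional quotients *)

(** A family of least size spanning modulo [M] is independent modulo [M]; coordinates are then
    unique, hence linear. *)
Lemma finite_codimensional_basis (R : realType) (G : normedModType R)
    (M : submodClosed G) : finite_codimensional M ->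
  exists (m : nat) (e : 'I_m -> G) (q : 'I_m -> G -> R),
    [/\ forall x, x - \sum_j q j x *: e j \in M,
        forall c : 'I_m -> R, \sum_j c j *: e j \in M -> c =1 (fun=> 0) &
        forall j, linear (q j : G -> R^o)].
Proof.
pose P n := `[< exists e : 'I_n -> G, forall x, exists c : 'I_n -> R,
  x - \sum_i c i *: e i \in M >].
move=> [n0 ne]; have exP : exists n, P n by exists n0; apply/asboolP.
case: (ex_minnP exP) => m /asboolP[e eM] mmin.
have indep (c : 'I_m -> R) : \sum_j c j *: e j \in M -> c =1 (fun=> 0).
  move=> cM i; apply: contrapT => /eqP ci0.
  case: m e eM mmin c cM i ci0 => [|m] e eM mmin c cM i ci0; first by case: i ci0.
  suff /mmin : P m by rewrite ltnn.
  apply/asboolP; exists (fun j => e (lift i j)) => x; have [d dM] := eM x.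
  (* The relation, scaled by [d i / c i], eliminates [e i] from the expansion of [x]. *)
  exists (fun j => d (lift i j) - d i / c i * c (lift i j)).
  have cM' : d i / c i *: (\sum_j c j *: e j) \in M by exact: rpredZ.
  suff -> : x - \sum_(j < m) (d (lift i j) - d i / c i * c (lift i j)) *: e (lift i j) =
      x - \sum_j d j *: e j + d i / c i *: (\sum_j c j *: e j) by exact: rpredD.
  under eq_bigr do rewrite scalerBl -scalerA.
  rewrite big_split /= sumrN -scaler_sumr !(bigD1_ord i)//= scalerDr scalerA divfK//.
  by rewrite opprB opprD -!addrA; congr (x + _); rewrite addrCA addKr addrC.
have /choice[q qM] x : exists c : 'I_m -> R, x - \sum_j c j *: e j \in M.
  exact: eM.
exists m, e, (fun j x => q x j); split=> // j a x y.
apply/eqP; rewrite -subr_eq0; apply/eqP.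
apply: (indep (fun j => q (a *: x + y) j - (a *: q x j + q y j))).
have -> : \sum_j (q (a *: x + y) j - (a *: q x j + q y j)) *: e j =
    (a *: (x - \sum_j q x j *: e j) + (y - \sum_j q y j *: e j))
    - (a *: x + y - \sum_j q (a *: x + y) j *: e j).
  under eq_bigr do rewrite scalerBl scalerDl -scalerA.
  rewrite big_split /= sumrN big_split /= -scaler_sumr scalerBr.
  by rewrite addrACA opprB [RHS]addrC subrKA opprD.
rewrite -[X in _ + X]scaleN1r; apply: rpredD; last exact: rpredZ.
by apply: rpredD; [exact: rpredZ|].
Qed.

Lemma cvg_sum (R : realType) (W : normedModType R) (T J : Type) (G : set_system T)
    {FG : Filter G} (r : seq J) (f : J -> T -> W) (l : J -> W) :
  (forall j, f j @ G --> l j) ->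
  (fun x => \sum_(j <- r) f j x) @ G --> \sum_(j <- r) l j.
Proof.
move=> fl; elim: r => [|j r ih].
  rewrite big_nil; under eq_fun do rewrite big_nil.
  exact: cvg_cst.
rewrite big_cons; under eq_fun do rewrite big_cons.
exact: cvgD.
Qed.

Lemma blin_continuous (R : realType) (E F : normedModType R) (T : blin E F) :
  continuous T.
Proof.
move=> x; have [C C0 TC] := blin_bounded T.
apply/cvgrPdist_lt => e e0; near=> z.
rewrite -(linear_mapB (blin_linear T)) (le_lt_trans (TC _))//.
have C1 : 0 < C + 1 by rewrite ltr_wpDl.
apply: (@le_lt_trans _ _ ((C + 1) * `|x - z|)); first by rewrite ler_wpM2r// lerDl.
rewrite mulrC -ltr_pdivlMr//; near: z.
by apply: cvgr_dist_lt; [exact: cvg_id|rewrite divr_gt0// ltr_wpDl].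
Unshelve. all: by end_near. Qed.

(** Compactness of the unit sphere of coefficients: a functional norming one vector norms nearby
    vectors up to the factor [1 + e], and finitely many such neighbourhoods cover the sphere.
    Independence of the [y j] keeps these vectors nonzero. *)
Lemma finite_norming_set (R : realType) (Y : normedModType R) (m : nat)
    (y : 'I_m -> Y) (e : R) :
  (forall z, exists c : 'I_m -> R, z = \sum_j c j *: y j) ->
  (forall c : 'I_m -> R, \sum_j c j *: y j = 0 -> c =1 (fun=> 0)) ->
  0 < e ->
  exists2 s : seq (blin Y R), (forall phi, phi \in s -> `|phi| <= 1) &
    forall z C, 0 <= C -> (forall phi : blin Y R, phi \in s -> phi z <= C) ->
      `|z| <= (1 + e) * C.
Proof.
move=> spany freey e0.
pose S := [set c : 'rV[R]_m | `|c| = 1].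
pose lc (c : 'rV[R]_m) := \sum_j c ord0 j *: y j.
have lcZ a c : lc (a *: c) = a *: lc c.
  by rewrite /lc scaler_sumr; apply: eq_bigr => j _; rewrite mxE scalerA.
have lc_cont : continuous lc.
  move=> c; apply: (cvg_sum (G := nbhs c)) => j; apply: cvgZr_tmp.
  exact: coord_continuous.
have cS : compact S.
  apply: bounded_closed_compact.
    exists 1; split=> // r r1 c /= ->; exact: ltW.
  have -> : S = (fun c : 'rV[R]_m => `|c|) @^-1` [set x | x = 1] by [].
  apply: closed_comp; last exact: closed_eq.
  by move=> c _; exact: norm_continuous.
pose D := [set phi : blin Y R | `|phi| <= 1].
pose O (phi : blin Y R) := [set c | 0 < (1 + e) * phi (lc c) - `|lc c|].
move: cS; rewrite compact_cover => /(_ _ D O).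
case=> [phi _||s sD sS].
- have -> : O phi =
    (fun c : 'rV[R]_m => (1 + e) * (phi : blin Y R) (lc c) - `|lc c|) @^-1`
    [set x | 0 < x] by [].
  apply: open_comp.
    have phi_cont : continuous (fun c => (phi : blin Y R) (lc c)).
      move=> c; apply: (continuous_comp (f := lc)); first exact: lc_cont.
      exact: blin_continuous.
    have norm_cont : continuous (fun c => `|lc c|).
      move=> c; apply: (continuous_comp (f := lc)); first exact: lc_cont.
      exact: norm_continuous.
    move=> c _; apply: (cvgB (F := nbhs c)); last exact: norm_cont.
    by apply: (cvgMl_tmp (F := nbhs c)); exact: phi_cont.
  exact: open_gt.
- move=> c; rewrite -[S c]/(`|c| = 1) => c1.
  have [phi phi1 phic] := exists_norming_functional (lc c).
  exists phi => //; rewrite /O /= phic mulrDl mul1r addrAC subrr add0r.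
  rewrite mulr_gt0// normr_gt0; apply/eqP => c0.
  have : c = 0.
    by apply/rowP => j; rewrite mxE (freey _ c0).
  by move=> c00; move: c1; rewrite c00 normr0 => /esym/eqP; rewrite oner_eq0.
exists (finmap.enum_fset s) => [phi /sD|z C C0 sC]; first by rewrite inE.
have [->|z0] := eqVneq z 0; first by rewrite normr0 mulr_ge0// addr_ge0// ltW.
have [c0 zc0] := spany z; pose c := \row_j c0 j.
have zc : z = lc c by rewrite zc0 /lc; apply: eq_bigr => j _; rewrite mxE.
have c_neq0 : c != 0.
  apply: contraNneq z0 => c00.
  by rewrite zc c00 /lc big1// => j _; rewrite mxE scale0r.
have : S (`|c|^-1 *: c).
  by rewrite /S /= normrZ normfV normr_id mulVf ?normr_eq0.
move=> /sS[phi /= phis]; rewrite /O /= lcZ -zc normrZ normfV normr_id.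
rewrite subr_gt0.
rewrite (linear_mapZ (blin_linear (phi : blin Y R))) mulrCA.
rewrite ltr_pM2l ?invr_gt0 ?normr_gt0// => /ltW/le_trans; apply.
by rewrite ler_wpM2l ?sC// addr_ge0// ltW.
Qed.

Lemma blin_sumE (R : realType) (E F : normedModType R) (n : nat) (c : 'I_n -> R)
    (T : 'I_n -> blin E F) (x : E) :
  (\sum_i c i *: T i : blin E F) x = \sum_i c i *: T i x.
Proof. by rewrite (@linear_sumZ _ _ _ (fun S : blin E F => S x)). Qed.

(* The isometric identity [L(F, Y)'' = L(F'', Y)] for finite-dimensional [Y], in the
   form of the principle of local reflexivity due to Dean: on finitely many points
   the quotient map of [F''] is approximated by biadjoints of operators from [F]. *)
Lemma bidual_quotient_approx (R : realType) (F : normedModType R)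
    (M : closed_subspace (bidual F)) : finite_codimensional M ->
  exists (m : nat) (y : 'I_m -> quotient M),
    forall (n : nat) (xi : 'I_n -> bidual F) (d : R), 0 < d ->
    exists p : 'I_m -> blin F R,
      (forall v, `|\sum_j p j v *: y j| <= (1 + d) * `|v|) /\
      (forall i, `|\sum_j (xi i : blin (blin F R) R) (p j) *: y j
                   - quotient_map M (xi i)| <= d).
Proof.
move=> /finite_codimensional_basis[m [e [q [eM indep linq]]]].
pose y j := quotient_map M (e j); exists m, y => n xi d d0.
have linQ := @quotient_map_linear _ _ M.
have Qq x : quotient_map M x = \sum_j q j x *: y j.
  rewrite -(linear_sumZ linQ); apply/quotient_mapP; exact: eM.
have spany z : exists c : 'I_m -> R, z = \sum_j c j *: y j.
  by have [x <-] := quotient_map_surj z; exists (q^~ x); rewrite Qq.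
have freey (c : 'I_m -> R) : \sum_j c j *: y j = 0 -> c =1 (fun=> 0).
  rewrite -(linear_sumZ linQ) -(quotient_map0 M) => /quotient_mapP.
  by rewrite subr0; exact: indep.
(* Ensures [(1 + r) * (1 + r) <= 1 + 3 * r <= 1 + d], which absorbs the losses from the norming set
   and from Helly's theorem. *)
pose r := Num.min d 1 / 3.
have r0 : 0 < r by rewrite divr_gt0// lt_min d0 ltr01.
have [rd r1] : 3 * r <= d /\ 3 * r <= 1.
  by rewrite /r mulrC divfK//; split; rewrite ge_min lexx ?orbT.
have [s s1 snorm] := finite_norming_set spany freey r0.
pose phi (k : 'I_(size s)) : blin (quotient M) R := tnth (in_tuple s) k.
have phi1 k z : phi k z <= `|z|.
  apply: le_trans (ler_norm _) _; apply: le_trans (ler_opnorm _ _) _.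
  by rewrite -[leRHS]mul1r ler_wpM2r// -blin_normE s1// mem_tnth.
pose a k j := phi k (y j).
have sumy0 : 0 <= \sum_j `|y j| by exact: sumr_ge0.
(* An error [r'] in every coordinate amounts to at most [r] in norm. *)
pose r' := r / (1 + \sum_j `|y j|).
have r'0 : 0 < r' by rewrite divr_gt0// ltr_wpDr.
have [eta b ab|p [pa pq]] := @helly_approx R (dual F) _ n m a xi (fun i j => q j (xi i))
  _ r' r'0.
  (* By [ab], [sum_i b i j xi i] and [sum_k a k j eta k] are the same element of the bidual;
     applying [q j] leaves values of the [phi k], of norm at most [1], at the classes of the
     [eta k]. *)
  have -> : \sum_i \sum_j b i j * q j (xi i) =
      \sum_k phi k (quotient_map M (eta k)).
    rewrite exchange_big /=.
    under [RHS]eq_bigr do rewrite Qq (linear_sumZ (@blin_linear _ _ _ _)).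
    rewrite [RHS]exchange_big /=; apply: eq_bigr => j _.
    have <- : q j (\sum_i b i j *: xi i) = \sum_i b i j * q j (xi i).
      exact: (linear_sumZ (linq j)).
    have -> : \sum_i b i j *: xi i = \sum_k a k j *: eta k.
      by apply: blinP => g; rewrite !blin_sumE; exact/esym/ab.
    rewrite (linear_sumZ (linq j)).
    by apply: eq_bigr => k _; exact: mulrC.
  apply: ler_sum => k _; apply: le_trans (phi1 _ _) _.
  exact: quotient_norm_map.
exists p; split=> [v|i].
  apply: le_trans (snorm _ ((1 + r') * `|v|) _ _) _.
  - by rewrite mulr_ge0// addr_ge0// ltW.
  - move=> ph /(nthP 0)[k ks <-].
    rewrite (linear_sumZ (@blin_linear _ _ _ _)).
    have -> : \sum_j (p j : blin F R) v *: (nth 0 s k : blin _ R) (y j) =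
        (\sum_j a (Ordinal ks) j *: p j : blin F R) v.
      rewrite blin_sumE; apply: eq_bigr => j _.
      by rewrite /a /phi (tnth_nth 0); exact: mulrC.
    apply: le_trans (ler_norm _) _; apply: le_trans (ler_opnorm _ _) _.
    by rewrite ler_wpM2r//; exact: pa.
  - have r'r : r' <= r.
      by rewrite /r' ler_pdivrMr ?ltr_wpDr// ler_peMr ?(ltW r0)// lerDl.
    rewrite mulrA ler_wpM2r//; nra.
rewrite Qq -sumrB; apply: le_trans (ler_norm_sum _ _ _) _.
apply: (@le_trans _ _ (r' * \sum_j `|y j|)).
  rewrite mulr_sumr; apply: ler_sum => j _.
  by rewrite -scalerBl normrZ ler_wpM2r.
rewrite (@le_trans _ _ r)//; last by lra.
rewrite /r' mulrAC ler_pdivrMr ?ltr_wpDr// ler_wpM2l ?(ltW r0)//.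
by rewrite lerDr.
Qed.

(** * Finite domains in Lipschitz ideals *)

Lemma Lip_le (R : realType) (X Y : metricType R) (f : X -> Y) (k : R) :
  0 <= k -> lipschitz_with k f -> Lip f <= k.
Proof. by move=> k0 fk; apply: ge_inf => //; exists 0 => k' []. Qed.

Lemma Lip_ge0 (R : realType) (X Y : metricType R) (f : X -> Y) :
  lipschitz_map f -> 0 <= Lip f.
Proof.
move=> [k fk]; apply: lb_le_inf => [|k' []//]; exists `|k|; split=> // x y.
by apply: le_trans (fk x y) _; rewrite ler_wpM2r ?mdist_ge0// ler_norm.
Qed.

Lemma set_type_enum (T : choiceType) (A : set T) : finite_set A ->
  exists s : seq A, uniq s /\ forall x, x \in s.
Proof.
move=> /finite_seqP[s As]; have sA y : A y -> y \in s by rewrite As.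
exists (undup (pmap insub s)).
split=> [|x]; first exact: undup_uniq.
have Ax : A (val x) := set_mem (valP x).
by rewrite mem_undup mem_pmap_sub; exact: sA.
Qed.

Section ideal.
Context (R : realType) (I : lip_class R) (bI : banach_lip_ideal I).

Lemma bli_sum (X : pointed_metric R) (E : completeNormedModType R) (J : Type)
    (r : seq J) (f : J -> X -> E) (c : J -> R) :
  (forall j, lmem I X E (f j) /\ lnorm I X E (f j) <= c j) ->
  lmem I X E (fun x => \sum_(j <- r) f j x) /\
  lnorm I X E (fun x => \sum_(j <- r) f j x) <= \sum_(j <- r) c j.
Proof.
move=> fc; elim: r => [|j r [ih1 ih2]].
  under eq_fun do rewrite big_nil; rewrite big_nil; split; first exact: bli_0.
  have := bli_normZ bI 0 (bli_0 bI X E); rewrite normr0 mul0r.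
  by under eq_fun do rewrite scaler0; move=> ->.
under eq_fun do rewrite big_cons; rewrite big_cons.
have [fj1 fj2] := fc j; split; first exact: bli_D.
by apply: le_trans (bli_normD bI fj1 ih1) _; exact: lerD.
Qed.

(** The ideal property with the identity of [E] on the left, whose norm is only bounded by [1] since
    [E] may be trivial. *)
Lemma bli_precomp (X Y : pointed_metric R) (E : completeNormedModType R)
    (g : Y -> X) (f : X -> E) :
  lipschitz_with 1 g -> g (pm_base Y) = pm_base X -> lmem I X E f ->
  lmem I Y E (f \o g) /\ lnorm I Y E (f \o g) <= lnorm I X E f.
Proof.
move=> g1 g0 fI.
have [|//||S S1 SE] := @blin_of_linear R E E idfun 1; first by [].
  by move=> x; rewrite mul1r.
have gl : Lip0 g by split=> //; exists 1.
have [h1 h2] := bli_comp bI S gl fI.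
have Sfg : S \o f \o g = f \o g by apply/funext => x /=; rewrite SE.
rewrite Sfg in h1 h2; split=> //; apply: le_trans h2 _.
have f0 := bli_norm_ge0 bI fI.
rewrite -[leRHS]mulr1 ler_pM//; first by rewrite mulr_ge0// Lip_ge0//; exists 1.
by rewrite -[leRHS]mul1r ler_wpM2r// Lip_le.
Qed.

Lemma bli_rank1 (X : pointed_metric R) (E : completeNormedModType R)
    (g : X -> R) (v : E) (k : R) :
  0 <= k -> @lipschitz_with R X (normed_metric R) k g -> g (pm_base X) = 0 ->
  lmem I X E (fun x => g x *: v) /\ lnorm I X E (fun x => g x *: v) <= k * `|v|.
Proof.
move=> k0 gk g0.
have [|//||S S1 SE] := @blin_of_linear R R E ( *:%R^~ v) `|v|.
- by move=> a x y; rewrite scalerDl scalerA.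
- by move=> x; rewrite normrZ mulrC.
have gl : @Lip0 R X (pm_normed R) g by split=> //; exists k.
have [iI i1] := bli_id bI.
have [h1 h2] := bli_comp bI S gl iI.
have Sg : S \o id \o g = (fun x => g x *: v) by apply/funext => x /=; rewrite SE.
rewrite Sg in h1 h2; split=> //; apply: le_trans h2 _; rewrite i1 mulr1.
by rewrite ler_pM//; [apply: Lip_ge0; exists k|exact: Lip_le].
Qed.

(** On a finite space, a map vanishing at the base point is a finite sum of rank-one maps built from
    indicators of points, which are Lipschitz because distinct points are uniformly separated. *)
Lemma bli_finite_domain (X : pointed_metric R) (E : completeNormedModType R)
    (s : seq X) : uniq s -> (forall x, x \in s) ->
  exists2 k, 0 <= k & forall h : X -> E, h (pm_base X) = 0 ->
    lmem I X E h /\ lnorm I X E h <= k * \sum_(x <- s) `|h x|.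
Proof.
move=> us sX.
(* Dominates every inverse distance, hence is a Lipschitz constant for all indicators; the diagonal
   terms are [0^-1 = 0]. *)
pose k := \sum_(x <- s) \sum_(y <- s) (mdist x y)^-1.
have k0 : 0 <= k.
  by apply: sumr_ge0 => x _; apply: sumr_ge0 => y _; rewrite invr_ge0 mdist_ge0.
have kP (x y : X) : x != y -> 1 <= k * mdist x y.
  move=> xy; have d0 : 0 < mdist x y by rewrite mdist_gt0.
  rewrite -ler_pdivrMr// mul1r /k (bigD1_seq x)//= (bigD1_seq y)//= -addrA.
  rewrite lerDl addr_ge0// ?sumr_ge0// => z _.
    by rewrite invr_ge0 mdist_ge0.
  by rewrite sumr_ge0// => w _; rewrite invr_ge0 mdist_ge0.
exists k => // h h0.
pose g (z x : X) : R := ((x == z) && (z != pm_base X))%:R.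
have hE : h = (fun x => \sum_(z <- s) g z x *: h z).
  apply/funext => x; rewrite (bigD1_seq x)//= big1 => [|z zx].
    rewrite addr0 /g eqxx /=; have [->|] := eqVneq x (pm_base X).
      by rewrite h0 scaler0.
    by rewrite scale1r.
  by rewrite /g eq_sym (negPf zx) scale0r.
rewrite [X in lmem _ _ _ X]hE [X in lnorm _ _ _ X]hE mulr_sumr.
apply: bli_sum => z; apply: bli_rank1 => // [x y|].
  have [->|xy] := eqVneq x y.
    by rewrite mdistxx mulr_ge0// mdist_ge0.
  apply: le_trans (kP x y xy); rewrite -[leLHS]/(`|g z x - g z y|) /g.
  by do 2!case: (_ && _); rewrite ?subrr ?subr0 ?sub0r ?normrN ?normr0 ?normr1.
by rewrite /g; case: eqVneq => //= <-; rewrite eqxx.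
Qed.

(** On a finite space pointwise closeness controls the ideal norm of the difference, so norm bounds
    pass to pointwise limits. *)
Lemma bli_finite_limit (X : pointed_metric R) (E : completeNormedModType R)
    (s : seq X) (h : X -> E) (C : R) :
  uniq s -> (forall x, x \in s) -> h (pm_base X) = 0 ->
  (forall e, 0 < e -> exists f : X -> E, [/\ lmem I X E f,
    lnorm I X E f <= C + e & forall x, `|h x - f x| <= e]) ->
  lmem I X E h /\ lnorm I X E h <= C.
Proof.
move=> us sX h0 hlim; have [k k0 kP] := bli_finite_domain E us sX.
split; first exact: (kP h h0).1.
apply/ler_addgt0Pr => e e0.
(* The errors [e / K] and [k * size s * (e / K)] add up to [e]. *)
pose K := 1 + k * (size s)%:R.
have K0 : 0 < K by rewrite ltr_wpDr// mulr_ge0.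
have [f [fI fn fh]] := hlim (e / K) (divr_gt0 e0 K0).
have f0 : f (pm_base X) = 0 by have [_] := bli_lip0 bI fI.
have [|dI dn] := kP (fun x => h x - f x); first by rewrite h0 f0 subrr.
have -> : h = (fun x => f x + (h x - f x)) by apply/funext => x; rewrite addrC subrK.
apply: le_trans (bli_normD bI fI dI) _.
have dn' : lnorm I X E (fun x => h x - f x) <= k * (size s)%:R * (e / K).
  apply: le_trans dn _; rewrite -mulrA ler_wpM2l//.
  rewrite mulr_natl -iter_addr_0 -count_predT -big_const_seq.
  by apply: ler_sum => x _; exact: fh.
apply: le_trans (lerD fn dn') _.
rewrite -addrA lerD2l -[X in X + _]mul1r -mulrDl -/K mulrC divfK//.
exact: lt0r_neq0.
Qed.
End ideal.

(** * Invariant means by iterated averaging *)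

Lemma ultra_bounded_cvg (R : realType) (T : Type) (U : set_system T)
    {UU : UltraFilter U} (f : T -> R) (B : R) :
  U [set t | `|f t| <= B] -> exists l : R, f @ U --> l.
Proof.
move=> UB; have cB : compact (`[(- B), B]%classic : set R) by exact: segment_compact.
have [|l [_ cl]] := cB (f @ U) _.
  suff : U (f @^-1` `[- B, B]) by [].
  by apply: filterS UB => t; rewrite /= in_itv /= ler_norml.
exists l => V Vl; have [//|UV] := in_ultra_setVsetC (f @^-1` V) UU.
have [] := cl (~` V) V UV Vl.
by move=> r [].
Qed.

Section averaging.
Context (R : realType) (E : zmodType) (J : Type).
Implicit Types (c : E -> J -> R) (w : E) (s : seq E).

(** The midpoint of [c] and its translate by [w], normalised at [0] like the translations of the
    ideal. In the application [J] is the dual of [F], and [c x] is an element of the bidual. *)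
Definition average w c : E -> J -> R :=
  fun x j => (c x j + (c (x + w) j - c w j)) / 2.

Definition averages s c := foldr average c s.

(** The subtracted constants combine symmetrically. This is the commutation on which the
    Markov-Kakutani argument rests. *)
Lemma averageC v w c : average v (average w c) = average w (average v c).
Proof.
apply/funext => x; apply/funext => j; rewrite /average.
by rewrite [x + w + v]addrAC [w + v]addrC; lra.
Qed.

Lemma average_averages w s c : average w (averages s c) = averages s (average w c).
Proof. by elim: s => //= v s ih; rewrite averageC ih. Qed.

(** By commutation the order of application is irrelevant; hence the filter of averages in
    [additive_fixpoint] is stable under intersection. *)
Lemma averages_cat s t c : averages (s ++ t) c = averages t (averages s c).
Proof.
rewrite /averages foldr_cat -/(averages s _) -/(averages t c) -/(averages t _).
by elim: s => //= v s ->; rewrite average_averages.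
Qed.

Fixpoint doublings n (a : E) :=
  if n is m.+1 then a *+ 2 ^ m :: doublings m a else [::].

(* Averaging along [a], [2 a], ..., [2 ^ (n - 1) a] is averaging over the translations
   by [k a] with [k < 2 ^ n], so the defect of additivity telescopes. *)
Lemma averages_doublings n a c x j (d := averages (doublings n a) c) :
  d (x + a) j - d x j - d a j =
  (c (x + a *+ 2 ^ n) j - c x j - c (a *+ 2 ^ n) j) / 2 ^+ n.
Proof.
rewrite {}/d; elim: n x => [|n ih] x /=; first by rewrite mulr1n expr0 divr1.
set d := averages _ c in ih *; set w := a *+ 2 ^ n in ih *.
have h1 := ih x; have h2 := ih (x + w); have h3 := ih w.
have -> : a *+ 2 ^ n.+1 = w + w by rewrite expnS mul2n -addnn mulrnDr.
(* With [D] the defect of [d] in the direction [a], the defect of the average is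
   [(D x + D (x + w) - D w) / 2]; as [w] is [2 ^ n] times [a], the numerators telescope. *)
have -> : average w d (x + a) j - average w d x j - average w d a j =
   ((d (x + a) j - d x j - d a j) + (d (x + w + a) j - d (x + w) j - d a j)
    - (d (w + a) j - d w j - d a j)) / 2.
  by rewrite /average [x + a + w]addrAC [a + w]addrC; lra.
rewrite h1 h2 h3 exprS addrA; have : (2 : R) ^+ n != 0 by rewrite expf_neq0.
by move: (2 ^+ n) => k k0; field.
Qed.

(** Iterated averages of [K] generate a filter; an ultrafilter refining it has a pointwise limit,
    which lies in [K] by closedness. Averaging along [n] doublings of [a] leaves a defect of order
    [2^-n], uniformly on [K], so the limit has none. *)
Lemma additive_fixpoint (A : set E) (K : set (E -> J -> R)) :
  (forall a, A a -> A (a + a)) -> K !=set0 ->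
  (forall c w, K c -> A w -> K (average w c)) ->
  (forall c j, K c -> c 0 j = 0) ->
  (forall x j, exists B, forall c w, K c -> `|c (x + w) j - c w j| <= B) ->
  (forall U (c : E -> J -> R), ProperFilter U -> U K ->
    (forall x j, (fun d : E -> J -> R => d x j) @ U --> c x j) -> K c) ->
  exists2 c, K c & forall a x j, A a -> c (x + a) j = c x j + c a j.
Proof.
move=> A2 [c0 Kc0] Kavg K0 Kbnd Kclosed.
pose Fil := [set S : set (E -> J -> R) | exists s,
  (forall w, w \in s -> A w) /\ forall c, K c -> S (averages s c)].
have Kavgs s c : (forall w, w \in s -> A w) -> K c -> K (averages s c).
  elim: s => //= v s ih sA Kc; apply: Kavg; last by apply: sA; rewrite mem_head.
  by apply: ih => // w ws; apply: sA; rewrite in_cons ws orbT.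
have FilF : ProperFilter Fil.
  apply: Build_ProperFilter_ex.
    by move=> S [s [_ sS]]; exists (averages s c0); exact: sS.
  split.
  - by exists [::].
  - move=> S S' [s [sA sS]] [s' [s'A s'S]]; exists (s ++ s'); split.
      by move=> w; rewrite mem_cat => /orP[/sA|/s'A].
    move=> c Kc; split; last by rewrite averages_cat; apply: s'S; exact: Kavgs.
    by rewrite /averages foldr_cat; apply: sS; exact: Kavgs.
  - by move=> S S' SS' [s [sA sS]]; exists s; split=> // c /sS/SS'.
have [U [UU FilU]] := ultraFilterLemma FilF.
have UK : U K by apply: FilU; exists [::].
have /choice[c1 c1P] (xj : E * J) : exists l : R,
    (fun d : E -> J -> R => d xj.1 xj.2) @ U --> l.
  case: xj => x j; have [B xB] := Kbnd x j.
  apply: (@ultra_bounded_cvg _ _ _ _ _ B); apply: filterS UK => d Kd /=.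
  by have := xB d 0 Kd; rewrite addr0 K0// subr0.
pose c x j := c1 (x, j).
have cP x j : (fun d : E -> J -> R => d x j) @ U --> c x j by exact: (c1P (x, j)).
exists c; first exact: Kclosed cP.
move=> a x j Aa; apply/eqP; rewrite -subr_eq0 opprD addrA -normr_le0.
have [B xB] := Kbnd x j.
have cvgD3 : (fun d : E -> J -> R => `|d (x + a) j - d x j - d a j|) @ U -->
    `|c (x + a) j - c x j - c a j|.
  by apply: cvg_norm; apply: cvgB; [apply: cvgB|]; exact: cP.
have le_n n : `|c (x + a) j - c x j - c a j| <= (B + B) * 2^-1 ^+ n.
  rewrite -(cvg_lim (@Rhausdorff R) cvgD3); apply: limr_le; first exact: cvgP cvgD3.
  have An m : A (a *+ 2 ^ m).
    by elim: m => [//|m ih]; rewrite expnS mul2n -addnn mulrnDr; exact: A2.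
  have : U [set averages (doublings n a) d | d in K].
    apply: FilU; exists (doublings n a); split; last by move=> d Kd; exists d.
    elim: n => //= n ih w; rewrite in_cons => /orP[/eqP->|/ih//]; exact: An.
  apply: filterS => _ [d Kd <-]; rewrite averages_doublings exprVn.
  rewrite normrM normfV [`|2 ^+ n|]ger0_norm ?exprn_ge0//.
  rewrite ler_wpM2r ?invr_ge0 ?exprn_ge0//.
  (* Regrouped into two increments along [x], from [2 ^ n] times [a] and from [0], each bounded by
     [B]. *)
  rewrite addrAC (le_trans (ler_normB _ _))// lerD//; first exact: xB.
  by have := xB d 0 Kd; rewrite addr0 K0// subr0.
have lim0 : (fun n => (B + B) * 2^-1 ^+ n) @ \oo --> (0 : R).
  rewrite -(mulr0 (B + B)); apply: cvgMl_tmp; apply: cvg_expr.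
  by rewrite ger0_norm// invf_lt1// ltr1n.
rewrite -(cvg_lim (@Rhausdorff R) lim0); apply: limr_ge; first exact: cvgP lim0.
by apply: nearW => n; exact: le_n.
Qed.
End averaging.

(** * Averages of translates in the ideal *)

Lemma filter_all_seq (T : Type) (X : eqType) (U : set_system T) {FU : Filter U}
    (s : seq X) (P : X -> set T) :
  (forall x, U (P x)) -> U [set t | forall x, x \in s -> P x t].
Proof.
move=> UP; elim: s => [|x s ih]; first exact: filterS filterT.
apply: filterS2 (UP x) ih => t Px ih y; rewrite in_cons => /orP[/eqP->//|].
exact: ih.
Qed.

Lemma cvg_near_unique (R : realType) (T : Type) (U : set_system T)
    {PU : ProperFilter U} (g h : T -> R) (l l' : R) :
  g @ U --> l -> h @ U --> l' -> U [set t | g t = h t] -> l = l'.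
Proof.
move=> gl hl' Ugh; rewrite -(cvg_lim (@Rhausdorff R) gl).
apply: cvg_lim; first exact: Rhausdorff.
move=> V Vl'; suff : U (g @^-1` V) by [].
have Uh : U (h @^-1` V) := hl' V Vl'.
apply: (filterS _ (filterI Ugh Uh)) => t [/= gh Vht].
by rewrite /= gh.
Qed.

Section translates.
Context (R : realType) (I : lip_class R) (bI : banach_lip_ideal I)
  (tI : translation_invariant I) (E F : completeNormedModType R) (N : R).
Implicit Types (c d : E -> blin F R -> R).

(* The family [c] plays the role of a map from [E] to [F'']: its composition with the
   biadjoint of a finite-rank operator [sum_j p_j (x) y_j] on [F] is controlled in [I]. *)
Definition ideal_bounded c :=
  forall (X : set E) (X0 : X 0), finite_set X ->
  forall (Y : completeNormedModType R) (m : nat) (y : 'I_m -> Y)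
    (p : 'I_m -> blin F R) (C : R),
  0 <= C -> (forall v, `|\sum_j p j v *: y j| <= C * `|v|) ->
  let pX := @pm_sub R (pm_normed E) X X0 in
  lmem I pX Y (fun x => \sum_j c (val x) (p j) *: y j) /\
  lnorm I pX Y (fun x => \sum_j c (val x) (p j) *: y j) <= C * N.

Lemma ideal_bounded_map (f : E -> F) :
  lmem I (pm_normed E) F f -> lnorm I (pm_normed E) F f <= N ->
  ideal_bounded (fun x phi => phi (f x)).
Proof.
move=> fI fN X X0 finX Y m y p C C0 pC pX.
have [a u v||//|S SC SE] := @blin_of_linear R F Y (fun v => \sum_j p j v *: y j) C.
- rewrite scaler_sumr -big_split; apply: eq_bigr => j _.
  by rewrite blin_linear scalerDl scalerA.
- by [].
have vl : @lipschitz_with R pX (normed_metric E) 1 val.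
  by move=> x z; rewrite mul1r.
have vl0 : @Lip0 R pX (pm_normed E) val by split=> //; exists 1.
have [h1 h2] := bli_comp bI S vl0 fI.
have SfE : S \o f \o val = (fun x : pX => \sum_j p j (f (val x)) *: y j).
  by apply/funext => x /=; rewrite SE.
rewrite SfE in h1 h2; split=> //; apply: le_trans h2 _.
have f0 := bli_norm_ge0 bI fI.
rewrite mulrC ler_pM//; first by rewrite mulr_ge0// Lip_ge0//; exists 1.
apply: le_trans fN; rewrite -[leRHS]mul1r ler_wpM2r//.
exact: Lip_le.
Qed.

(** Translation invariance is applied on the finite set [X'], which contains [w] since [0] is in
    [X]. After translation by [w] this set contains [X], and restricting along the isometric
    inclusion does not increase the norm. *)
Lemma ideal_bounded_shift c w : ideal_bounded c -> (forall phi, c 0 phi = 0) ->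
  ideal_bounded (fun x phi => c (x + w) phi - c w phi).
Proof.
move=> cI c0 X X0 finX Y m y p C C0 pC pX.
pose X' : set E := [set x + w | x in X] `|` [set 0].
have X'0 : X' 0 by right.
have X'w : X' w by left; exists 0 => //; rewrite add0r.
have finX' : finite_set X'.
  by rewrite finite_setU; split; [exact: finite_image|exact: finite_set1].
have [gI gN] := cI X' X'0 finX' Y m y p C C0 pC.
set g := (fun x => _) in gI gN.
have gL : @Lip0 R (@pm_sub R (pm_normed E) X' X'0) (pm_normed Y) g.
  exact: bli_lip0 bI _ _ _ gI.
pose w' : X' := exist _ w (mem_set X'w).
have [[tgI' _] /(_ gI) tgN] := @tI E Y X' X'0 w' g gL.
have tgI := tgI' gI.
have XX' x : X x -> translated_set w' x.
  by move=> Xx; exists (x + w); [left; exists x|rewrite addrK].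
pose j (x : pX) : @pm_sub R (pm_normed E) (translated_set w') (translated_set0 w') :=
  exist _ (val x) (mem_set (XX' _ (set_mem (valP x)))).
have j1 : lipschitz_with 1 j by move=> x z; rewrite mul1r.
have j0 : j (pm_base pX) = pm_base _ by exact: val_inj.
have [h1 h2] := bli_precomp bI j1 j0 tgI.
have tgE : translated_map g \o j =
    (fun x : pX => \sum_j (c (val x + w) (p j) - c w (p j)) *: y j).
  apply/funext => x; rewrite /= /translated_map /g /=.
  by rewrite -sumrB; apply: eq_bigr => k _; rewrite scalerBl.
rewrite tgE in h1 h2; split=> //; apply: le_trans h2 _.
by rewrite -tgN.
Qed.

Lemma ideal_bounded_average c w : ideal_bounded c -> (forall phi, c 0 phi = 0) ->
  ideal_bounded (average w c).
Proof.
move=> cI c0 X X0 finX Y m y p C C0 pC pX.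
have [h1 h2] := cI X X0 finX Y m y p C C0 pC.
have [k1 k2] := ideal_bounded_shift w cI c0 X0 finX C0 pC.
set g := (fun x => _) in h1 h2; set g' := (fun x => _) in k1 k2.
have -> : (fun x : pX => \sum_j average w c (val x) (p j) *: y j) =
    (fun x : pX => 2^-1 *: (g x + g' x)).
  apply/funext => x; rewrite /g /g' -big_split scaler_sumr; apply: eq_bigr => j _.
  by rewrite /= -scalerDl scalerA mulrC.
have gg' := bli_D bI h1 k1; split; first exact: bli_Z.
rewrite (bli_normZ bI 2^-1 gg') ger0_norm ?invr_ge0//.
have := bli_normD bI h1 k1; lra.
Qed.

Lemma ideal_bounded_limit (U : set_system (E -> blin F R -> R)) c :
  ProperFilter U -> U ideal_bounded -> (forall phi, c 0 phi = 0) ->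
  (forall x phi, (fun d => d x phi) @ U --> c x phi) -> ideal_bounded c.
Proof.
move=> FU UI c0 Uc X X0 finX Y m y p C C0 pC pX.
have [s [us sX]] := set_type_enum finX.
apply: (@bli_finite_limit R I bI pX Y s _ _ us sX) => [|e e0].
  by apply: big1 => j _; rewrite /= c0 scale0r.
have : U [set d | forall x : X, x \in s ->
    `|\sum_j c (val x) (p j) *: y j - \sum_j d (val x) (p j) *: y j| <= e].
  apply: (filter_all_seq s (P := fun x => [set d | `|\sum_j c (val x) (p j) *: y j
    - \sum_j d (val x) (p j) *: y j| <= e])) => x.
  have h : (fun d => \sum_j d (val x) (p j) *: y j) @ U -->
      \sum_j c (val x) (p j) *: y j.
    by apply: cvg_sum => j; apply: cvgZr_tmp; exact: Uc.
  by move/cvgrPdist_lt: h => /(_ _ e0); apply: filterS => d; exact: ltW.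
move=> /(filterI UI)/filter_ex[d [dI dc]].
have [h1 h2] := dI X X0 finX Y m y p C C0 pC.
exists (fun x : pX => \sum_j d (val x) (p j) *: y j); split=> //.
  by apply: le_trans h2 _; rewrite lerDl ltW.
by move=> x; apply: dc.
Qed.

(** The convex set for the fixpoint argument. Elements of the bidual are kept as plain functions of
    [phi], so that each clause passes to pointwise limits; their boundedness follows from the first
    and third clauses. *)
Definition lip_family (L : R) c :=
  [/\ forall phi, c 0 phi = 0,
      forall x a phi psi, c x (a *: phi + psi) = a * c x phi + c x psi,
      forall x y phi, `|c x phi - c y phi| <= L * `|x - y| * `|phi| &
      ideal_bounded c].

Lemma lip_family_average L c w : lip_family L c -> lip_family L (average w c).
Proof.
move=> [c0 clin cL cI]; split.
- by move=> phi; rewrite /average c0 !add0r subrr mul0r.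
- by move=> x a phi psi; rewrite /average !clin; lra.
- move=> x y phi; rewrite /average.
  have h1 := cL x y phi; have := cL (x + w) (y + w) phi.
  rewrite opprD addrACA subrr addr0 => h2.
  have -> : (c x phi + (c (x + w) phi - c w phi)) / 2 -
      (c y phi + (c (y + w) phi - c w phi)) / 2 =
      ((c x phi - c y phi) + (c (x + w) phi - c (y + w) phi)) / 2 by lra.
  rewrite normrM [`|2^-1|]ger0_norm ?invr_ge0//.
  have := ler_normD (c x phi - c y phi) (c (x + w) phi - c (y + w) phi); lra.
- exact: ideal_bounded_average.
Qed.

Lemma lip_family_limit L (U : set_system (E -> blin F R -> R)) c :
  ProperFilter U -> U (lip_family L) ->
  (forall x phi, (fun d => d x phi) @ U --> c x phi) -> lip_family L c.
Proof.
move=> FU UL Uc.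
have c0 phi : c 0 phi = 0.
  apply: (cvg_near_unique (Uc 0 phi) (cvg_cst _)).
  by apply: filterS UL => d [d0 _ _ _]; exact: d0.
split=> //.
- move=> x a phi psi.
  have h : (fun d => a * d x phi + d x psi) @ U --> a * c x phi + c x psi.
    by apply: cvgD; [apply: cvgMl_tmp; exact: Uc|exact: Uc].
  apply: (cvg_near_unique (Uc x (a *: phi + psi)) h).
  by apply: filterS UL => d [_ dlin _ _]; exact: dlin.
- move=> x y phi.
  have h : (fun d => `|d x phi - d y phi|) @ U --> `|c x phi - c y phi|.
    by apply: cvg_norm; apply: cvgB; exact: Uc.
  rewrite -(cvg_lim (@Rhausdorff R) h); apply: limr_le; first exact: cvgP h.
  by apply: filterS UL => d [_ _ dL _]; exact: dL.
- apply: ideal_bounded_limit Uc => //.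
  by apply: filterS UL => d [].
Qed.
End translates.

(** * From additive families to operators into the bidual *)

(** Comparing [n * t] with its integer part bounds [n] times the difference of the two sides by
    [B + |g 1|] for every [n], so the difference vanishes for [t >= 0]; oddness gives the rest. *)
Lemma additive_bounded_homogeneous (R : realType) (g : R -> R) (B : R) :
  (forall s t, g (s + t) = g s + g t) -> (forall t, `|g t| <= B * `|t|) ->
  forall t, g t = t * g 1.
Proof.
move=> gD gB.
have g0 : g 0 = 0 by apply: (addrI (g 0)); rewrite -gD !addr0.
have gN t : g (- t) = - g t by apply: (addrI (g t)); rewrite -gD !subrr.
have gM n t : g (n%:R * t) = n%:R * g t.
  elim: n => [|n ih]; first by rewrite !mul0r.
  by rewrite -natr1 !mulrDl !mul1r gD ih.
have B0 : 0 <= B by have := gB 1; rewrite normr1 mulr1; apply: le_trans.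
suff pos t : 0 <= t -> g t = t * g 1.
  move=> t; have [/pos//|t0] := leP 0 t.
  by rewrite -[t]opprK gN pos ?oppr_ge0 ?ltW// !mulNr.
move=> t0; apply/eqP; rewrite -subr_eq0 -normr_le0 leNgt; apply/negP => d0.
pose M := B + `|g 1|.
have M0 : 0 <= M by rewrite addr_ge0.
have := archi_boundP (divr_ge0 M0 (ltW d0)).
set n := Num.bound _; rewrite ltr_pdivrMr// ltNge => /negP; apply.
have /andP[k1 k2] := truncn_itv (mulr_ge0 (ler0n R n) t0).
set k := Num.truncn _ in k1 k2.
have -> : n%:R * `|g t - t * g 1| = `|g (n%:R * t - k%:R * 1) + (k%:R - n%:R * t) * g 1|.
  rewrite -[in LHS](normr_nat R n) -normrM gD gN !gM; congr `|_|; ring.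
rewrite (le_trans (ler_normD _ _))// lerD//.
  apply: le_trans (gB _) _; rewrite -[leRHS]mulr1 ler_wpM2l// ger0_norm; lra.
rewrite normrM -[leRHS]mul1r ler_wpM2r// ler_norml; lra.
Qed.

Section linear_family.
Context (R : realType) (I : lip_class R) (E F : completeNormedModType R) (N L : R).

(** The Lipschitz clause against [0] places [c x] in the bidual; homogeneity in [x] comes from
    additivity and boundedness along each line. *)
Lemma additive_lip_family_blin (c : E -> blin F R -> R) :
  0 <= L -> lip_family I N L c ->
  (forall x y phi, c (x + y) phi = c x phi + c y phi) ->
  exists S : blin E (bidual F), forall x phi, (S x : blin (blin F R) R) phi = c x phi.
Proof.
move=> L0 [c0 clin cL _] cD.
have cB x phi : `|c x phi| <= L * `|x| * `|phi|.
  by have := cL x 0 phi; rewrite c0 !subr0.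
have /choice[S SP] x : exists T : blin (blin F R) R,
    `|T| <= L * `|x| /\ forall phi, T phi = c x phi.
  have [a phi psi|||T T1 TE] := @blin_of_linear R (blin F R) R (c x) (L * `|x|).
  - exact: clin.
  - exact: mulr_ge0.
  - exact: cB.
  - by exists T.
have SE x phi : (S x : blin (blin F R) R) phi = c x phi by exact: (SP x).2.
have [a x y|//|x|T _ TE] := @blin_of_linear R E (bidual F) S L.
- apply: blinP => phi; rewrite blinD blinZ !SE cD; congr (_ + _).
  pose g t := c (t *: x) phi.
  have gE := @additive_bounded_homogeneous R g (L * `|x| * `|phi|).
  have := gE _ _ a; rewrite /g scale1r; apply=> [s t|t]; first by rewrite scalerDl cD.
  apply: le_trans (cB _ _) _; rewrite normrZ; lra.
- exact: (SP x).1.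
- by exists T => x phi; rewrite TE SE.
Qed.
End linear_family.

(** * Membership in a maximal ideal *)

(** The extended norm is [+oo] off the ideal, so the supremum is bounded by [C] once each finite
    piece is shown to belong to the ideal with norm at most [C]. *)
Lemma lmem_maximal (R : realType) (I : lip_class R) (X : pointed_metric R)
    (E : completeNormedModType R) (f : X -> E) (C : R) :
  maximal_lip_ideal I -> 0 <= C -> @Lip0 R X (pm_normed E) f ->
  (forall (X0 : set X) (X00 : X0 (pm_base X)) (M : closed_subspace E),
    finite_set X0 -> finite_codimensional M ->
    let g := fun x : pm_sub X00 => quotient_map M (f (val x)) in
    lmem I (pm_sub X00) (quotient M) g /\ lnorm I (pm_sub X00) (quotient M) g <= C) ->
  lmem I X E f /\ lnorm I X E f <= C.
Proof.
move=> mI C0 fL fC; have [fI fN] := mI X E f.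
have eC : (max_enorm I f <= C%:E)%E.
  apply: ge_ereal_sup => _ [X0 [X00 [M [finX0 finM ->]]]].
  have [gI gN] := fC X0 X00 M finX0 finM.
  by rewrite /lenorm asboolT// lee_fin.
have {}fI : lmem I X E f by apply/fI; split=> //; exact: le_lt_trans eC (ltry _).
(* A value [-oo] would be read as [0] by [fine], which [C0] covers. *)
split=> //; rewrite fN//=; move: eC; case: (max_enorm I f) => //.
Qed.

(** On a finite set the quotient map of the bidual is approximated by the biadjoint of a finite-rank
    operator on [F] of norm at most [1 + d], to which [ideal_bounded] applies; [bli_finite_limit]
    removes the error. *)
Lemma lip_family_lmem (R : realType) (I : lip_class R) (E F : completeNormedModType R)
    (N : R) (S : blin E (bidual F)) :
  banach_lip_ideal I -> maximal_lip_ideal I -> 0 <= N ->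
  ideal_bounded I N (fun x phi => (S x : blin (blin F R) R) phi) ->
  lmem I (pm_normed E) (bidual F) S /\ lnorm I (pm_normed E) (bidual F) S <= N.
Proof.
move=> bI mI N0 SI; apply: lmem_maximal => //.
  split; last exact: blin0.
  exists (opnorm S) => x y; rewrite -[leLHS]/(`|S x - S y|).
  by rewrite -(linear_mapB (blin_linear S)); exact: ler_opnorm.
move=> X X0 M finX finM.
have [m [y yP]] := bidual_quotient_approx finM.
have [s [us sX]] := set_type_enum finX.
apply: (@bli_finite_limit R I bI (@pm_sub R (pm_normed E) X X0) _ s _ _ us sX) => [|e e0].
  by rewrite /= blin0 quotient_map0.
(* The first bound controls the pointwise error, the second gives [(1 + d) * N <= N + e]; [N + 1] is
   positive even if [N = 0]. *)
pose d := Num.min e (e / (N + 1)).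
have N1 : 0 < N + 1 by rewrite ltr_wpDl.
have d0 : 0 < d by rewrite lt_min e0 divr_gt0.
have [p [pC pS]] := yP (size s) (fun i => S (val (tnth (in_tuple s) i))) d d0.
have [|gI gN] := SI X X0 finX (quotient M) m y p (1 + d) _ pC.
  by rewrite addr_ge0// ltW.
exists (fun x => \sum_j (S (val x) : blin (blin F R) R) (p j) *: y j); split=> //.
  apply: le_trans gN _; rewrite mulrDl mul1r lerD2l.
  apply: (@le_trans _ _ (d * (N + 1))); first by rewrite ler_wpM2l ?(ltW d0)// lerDl.
  by rewrite -ler_pdivlMr// ge_min lexx orbT.
move=> x; have /tnthP[i xi] : x \in in_tuple s by exact: sX.
rewrite distrC xi; apply: le_trans (pS i) _.
by rewrite ge_min lexx.
Qed.

(** * The extension by two rounds of averaging *)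

Unset Implicit Arguments.
Set Strict Implicit.
Set Printing Implicit Defensive.

Theorem theorem1 (R : realType) (E F : completeNormedModType R)
    (E0 : submodClosed E) (T : blin (subspace_type E0) F)
    (f : E -> F) (I : lip_class R) :
  @lipschitz_map R (normed_metric E) (normed_metric F) f ->
  (forall x : subspace_type E0, f (val x) = T x) ->
  banach_lip_ideal I -> maximal_lip_ideal I -> translation_invariant I ->
  lmem I (pm_normed E) F f ->
  exists S : blin E (bidual F),
    [/\ lmem I (pm_normed E) (bidual F) S,
        forall x : subspace_type E0, S (val x) = bidual_embedding (T x) &
        lnorm I (pm_normed E) (bidual F) S <= lnorm I (pm_normed E) F f].
Proof.
move=> [L0 fL0] fT bI mI tI fI.
set N := lnorm I (pm_normed E) F f; pose L := `|L0|.
have N0 : 0 <= N := bli_norm_ge0 bI fI.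
have fL x y : `|f x - f y| <= L * `|x - y|.
  by apply: le_trans (fL0 x y) _; apply: ler_wpM2r; [exact: mdist_ge0|exact: ler_norm].
have f0 : f 0 = 0 by have [_] := bli_lip0 bI fI.
have fE0 x a : x \in E0 -> a \in E0 -> f (x + a) = f x + f a.
  move=> xE aE; pose x' : subspace_type E0 := exist _ x xE.
  pose a' : subspace_type E0 := exist _ a aE.
  rewrite -[x + a]/(val (x' + a')) -[f x]/(f (val x')) -[f a]/(f (val a')) !fT.
  exact: (linear_mapD (blin_linear T)).
pose K := lip_family I N L : set (E -> blin F R -> R).
(* Two rounds: averaging along any [w] in [E] preserves the values on [E0] once the family is
   additive in the directions of [E0], and a first averaging along [E0] alone provides this
   additivity. *)
pose K0 := [set c | K c /\ forall x phi, x \in E0 -> c x phi = phi (f x)].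
pose K1 := [set c | K0 c /\
  forall a x phi, a \in E0 -> c (x + a) phi = c x phi + c a phi].
have Kbnd x phi c w : K c -> `|c (x + w) phi - c w phi| <= L * `|x| * `|phi|.
  by move=> [_ _ cL _]; apply: le_trans (cL _ _ _) _; rewrite addrK.
have Kf : K (fun x phi => phi (f x)).
  split=> [phi|x a phi psi|x y phi|].
  - by rewrite f0 blin0.
  - by [].
  - rewrite -(linear_mapB (blin_linear phi)); apply: le_trans (ler_opnorm _ _) _.
    rewrite mulrC -blin_normE.
    by rewrite ler_wpM2r.
  - exact: (ideal_bounded_map bI fI).
(* For [w] in [E0] the translate still agrees with [f] on [E0], as [f] is additive there. *)
have K0avg c w : K0 c -> w \in E0 -> K0 (average w c).
  move=> [Kc cE0] wE; split; first exact: lip_family_average.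
  move=> x phi xE; rewrite /average !cE0 ?rpredD// fE0//.
  by rewrite (linear_mapD (blin_linear phi)); lra.
have K0lim U c : ProperFilter U -> U K0 ->
    (forall x phi, (fun d : E -> blin F R -> R => d x phi) @ U --> c x phi) -> K0 c.
  move=> PU UK0 Uc; split.
    by apply: (lip_family_limit bI PU _ Uc); apply: filterS UK0 => d [].
  move=> x phi xE; apply: (cvg_near_unique (Uc x phi) (cvg_cst _)).
  by apply: filterS UK0 => d [_]; apply.
have [c1 K0c1 c1E0] : exists2 c, K0 c &
    forall a x phi, a \in E0 -> c (x + a) phi = c x phi + c a phi.
  apply: (@additive_fixpoint R E (blin F R) [set a | a \in E0] K0) => //.
  - by move=> a aE; exact: rpredD.
  - by exists (fun x phi => phi (f x)).
  - by move=> c phi [[c0 _ _ _] _].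
  - by move=> x phi; exists (L * `|x| * `|phi|) => c w [Kc _]; exact: Kbnd.
have [c K1c cD] : exists2 c, K1 c &
    forall a x phi, setT a -> c (x + a) phi = c x phi + c a phi.
  apply: (@additive_fixpoint R E (blin F R) setT K1) => //.
  - by exists c1.
  - move=> d w [[Kd dE0] dD] _; split; last first.
      move=> a x phi aE; rewrite /average [x + a + w]addrAC [a + w]addrC.
      by rewrite !(dD a _ _ aE); lra.
    split; first exact: lip_family_average.
    (* For [x] in [E0], membership in [K1] gives [d (w + x) - d w = d x], so the values on [E0] are
       unchanged. *)
    move=> x phi xE; rewrite /average [x + w]addrC (dD x w phi xE) (dE0 x phi xE); lra.
  - by move=> d phi [[[d0 _ _ _] _] _].
  - by move=> x phi; exists (L * `|x| * `|phi|) => d w [[Kd _] _]; exact: Kbnd.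
  - move=> U d PU UK1 Ud; split.
      by apply: (K0lim U) => //; apply: filterS UK1 => d' [].
    move=> a x phi aE; apply: (cvg_near_unique (Ud (x + a) phi)
      (cvgD (Ud x phi) (Ud a phi))).
    by apply: filterS UK1 => d' [_]; apply.
have [[Kc cE0] _] := K1c.
have [|x y phi|S SE] := @additive_lip_family_blin _ I E F N L c _ Kc.
- exact: normr_ge0.
- exact: cD.
have SI : ideal_bounded I N (fun x phi => (S x : blin (blin F R) R) phi).
  have -> : (fun x phi => (S x : blin (blin F R) R) phi) = c.
    by apply/funext => x; apply/funext => phi.
  by have [] := Kc.
have [Smem SN] := lip_family_lmem bI mI N0 SI.
exists S; split=> // x; apply: blinP => phi.
by rewrite SE cE0 ?fT//; exact: valP.
Qed.
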